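(* (a) Let $G(s)$ be an $n\times n$ strictly proper complex symmetric transfer function of McMillan degree $\delta>\binom{n+1}{2}$ (resp. a Hamiltonian transfer function with $\delta>n(n+1)$). Then $G$ is not generically pole assignable by symmetric feedback: the set of closed-loop characteristic polynomials $\{\varphi_F: F\in\mathrm{Sym}(n)\}$ does not contain a nonempty Zariski open subset of the space of monic polynomials of degree $\delta$ (resp. of monic even polynomials of degree $\delta$); this holds for real as well as complex symmetric $F$. (b) If $\delta\le\binom{n+1}{2}$ (resp. $\delta\le n(n+1)$ in the Hamiltonian case), then there is a nonempty Zariski open subset $\mathcal{U}$ of $SRat_{\delta,n}(\mathbb{C})$ (resp. of $Ham_{\delta,n}(\mathbb{C})$) such that every $G\in\mathcal{U}$ is generically pole assignable by complex symmetric feedback: the set $\{\varphi_F:F\in\mathrm{Sym}(n)\}$ contains a nonempty Zariski open subset of the affine space of monic polynomials of degree $\delta$ (resp. of monic even polynomials $\varphi(s)=\varphi(-s)$ of degree $\delta$).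
   Context: A strictly proper rational matrix $G(s)\in\mathbb{C}(s)^{n\times n}$ is symmetric if $G(s)=G(s)^t$ and Hamiltonian if $G(s)=G(-s)^t$. $SRat_{\delta,n}(\mathbb{C})$ and $Ham_{\delta,n}(\mathbb{C})$ denote the sets of strictly proper complex symmetric, resp. Hamiltonian, $n\times n$ transfer functions of McMillan degree $\delta$; they are irreducible quasi-affine varieties, and ''generic'' means ''belonging to a nonempty Zariski open subset''. $\mathrm{Sym}(n)$ is the space of complex symmetric $n\times n$ matrices. For $F\in\mathrm{Sym}(n)$ the closed-loop transfer function is $G_F(s)=(I_n-G(s)F)^{-1}G(s)$, and its closed-loop characteristic polynomial is $\varphi_F(s)=\det(sI_\delta-A-BFC)$ where $(A,B,C)$ is any minimal realization of $G$ (independent of the choice); its zeros are the poles of $G_F$. In the Hamiltonian case $\varphi_F$ is always even. *)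

(* Defs.v *)
(* The complex field is  C := R[i]  for  R : realType
   (mathcomp-analysis reals: R is a complete archimedean ordered field, i.e. R = ℝ,
   so R[i] = ℂ). *)
From HB Require Import structures.
From mathcomp Require Import all_boot all_order all_algebra.
From mathcomp Require Import fraction mpoly complex reals.
Set Implicit Arguments.
Unset Strict Implicit.
Unset Printing Implicit Defensive.
Import GRing.Theory Num.Theory.
Local Open Scope ring_scope.

Section Defs.
Variable R : realType.
Local Notation C := (R[i]).
Local Notation Cs := {fraction {poly C}}.

Definition sF : Cs := tofrac 'X.
Definition cstF (a : C) : Cs := tofrac a%:P.
Definition mxF m p (M : 'M[C]_(m, p)) : 'M[Cs]_(m, p) := map_mx cstF M.

Definition tf d n (A : 'M[C]_d) (B : 'M[C]_(d, n)) (Cm : 'M[C]_(n, d)) : 'M[Cs]_n :=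
  mxF Cm *m invmx (sF%:M - mxF A) *m mxF B.

Definition tf_neg d n (A : 'M[C]_d) (B : 'M[C]_(d, n)) (Cm : 'M[C]_(n, d)) : 'M[Cs]_n :=
  mxF Cm *m invmx ((- sF)%:M - mxF A) *m mxF B.

Definition realizable_dim n (G : 'M[Cs]_n) (d : nat) : Prop :=
  exists (A : 'M[C]_d) (B : 'M[C]_(d, n)) (Cm : 'M[C]_(n, d)), tf A B Cm = G.

(* G is a strictly proper rational matrix of McMillan degree d:
   d is the size of a minimal realization. *)
Definition mcmillan_degree n (G : 'M[Cs]_n) (d : nat) : Prop :=
  realizable_dim G d /\ (forall k, (k < d)%N -> ~ realizable_dim G k).

Definition symmetric_tf n (G : 'M[Cs]_n) : Prop := G^T = G.

(* Hamiltonian: G(s) = G(-s)^t, G(-s) being computed from a realization of G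
   (it does not depend on the realization). *)
Definition hamiltonian_tf n (G : 'M[Cs]_n) : Prop :=
  exists d (A : 'M[C]_d) (B : 'M[C]_(d, n)) (Cm : 'M[C]_(n, d)),
    tf A B Cm = G /\ (tf_neg A B Cm)^T = G.

Definition SRat d n (G : 'M[Cs]_n) : Prop := mcmillan_degree G d /\ symmetric_tf G.
Definition Ham d n (G : 'M[Cs]_n) : Prop := mcmillan_degree G d /\ hamiltonian_tf G.

(* phi_F(s) = det(sI - A - B F C) for a minimal realization (A,B,C) of G,
   i.e. a realization of size the McMillan degree d. *)
Definition cl_charpoly d n (A : 'M[C]_d) (B : 'M[C]_(d, n)) (Cm : 'M[C]_(n, d))
  (F : 'M[C]_n) : {poly C} := char_poly (A + B *m F *m Cm).

Definition cl_charpolys d n (G : 'M[Cs]_n) (p : {poly C}) : Prop :=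
  exists F : 'M[C]_n, F^T = F /\
  exists (A : 'M[C]_d) (B : 'M[C]_(d, n)) (Cm : 'M[C]_(n, d)),
    tf A B Cm = G /\ p = cl_charpoly A B Cm F.

Definition cl_charpolys_real d n (G : 'M[Cs]_n) (p : {poly C}) : Prop :=
  exists F : 'M[R]_n, F^T = F /\
  exists (A : 'M[C]_d) (B : 'M[C]_(d, n)) (Cm : 'M[C]_(n, d)),
    tf A B Cm = G /\
    p = cl_charpoly A B Cm (map_mx (fun x : R => (x%:C)%C) F).

Definition zariski_open N (O : ('I_N -> C) -> Prop) : Prop :=
  exists S : {mpoly C[N]} -> Prop,
    forall x, O x <-> ~ (forall p, S p -> p.@[x] = 0).

Definition contains_nonempty_open N (P : ('I_N -> C) -> Prop) : Prop :=
  exists O, zariski_open O /\ (exists x, O x) /\ (forall x, O x -> P x).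

Definition monic_of d (c : 'I_d -> C) : {poly C} :=
  'X^d + \sum_(i < d) c i *: 'X^i.

Definition even_monic_of m (c : 'I_m -> C) : {poly C} :=
  'X^(2 * m) + \sum_(i < m) c i *: 'X^(2 * i).

Definition contains_open_monic d (S : {poly C} -> Prop) : Prop :=
  contains_nonempty_open (fun c : 'I_d -> C => S (monic_of c)).
Definition contains_open_even_monic m (S : {poly C} -> Prop) : Prop :=
  contains_nonempty_open (fun c : 'I_m -> C => S (even_monic_of c)).

Definition triple_coords d n (A : 'M[C]_d) (B : 'M[C]_(d, n)) (Cm : 'M[C]_(n, d))
  : 'I_(d * d + (d * n + n * d)) -> C :=
  fun i => (row_mx (mxvec A) (row_mx (mxvec B) (mxvec Cm))) 0 i.

(* The variety V (= SRat_{d,n} or Ham_{d,n}) carries the quotient topology of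
   its space of minimal realizations (a locally closed subset of the affine space
   of triples, with the induced Zariski topology) under (A,B,C) |-> C(sI-A)^{-1}B.
   U is Zariski open in V iff U is contained in V and the set of minimal
   realizations of elements of U is the trace of an affine Zariski open set. *)
Definition open_in_variety d n (V : 'M[Cs]_n -> Prop) (U : 'M[Cs]_n -> Prop) : Prop :=
  (forall G, U G -> V G) /\
  exists O : ('I_(d * d + (d * n + n * d)) -> C) -> Prop,
    zariski_open O /\
    forall (A : 'M[C]_d) (B : 'M[C]_(d, n)) (Cm : 'M[C]_(n, d)),
      V (tf A B Cm) -> (U (tf A B Cm) <-> O (triple_coords A B Cm)).

End Defs.

(* Main.v *)
Require Import Defs.
From HB Require Import structures.
From mathcomp Require Import all_boot all_order all_algebra.
From mathcomp Require Import fraction mpoly complex reals.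
From mathcomp Require Import perm polyXY closed_field ring zify.
From mathcomp Require boolp.
Import GRing.Theory Num.Theory.
Set Implicit Arguments.
Unset Strict Implicit.
Unset Printing Implicit Defensive.
Local Open Scope ring_scope.

(** The McMillan degree d of G makes every realization of size d reachable and observable, so
    two of them are similar and the closed-loop polynomial depends on G and F only. In the
    Hamiltonian case (A, B, C) is similar to (-A^T, -C^T, B^T), which makes it even.

    (a) The coefficients of the closed-loop polynomial are polynomials in the binom(n+1, 2)
    entries of F. If there are more free coefficients than entries, they are algebraically
    dependent, and the image lies in a hypersurface.

    (b) The coefficient of s^l in det(s - A - t B X C) has t-derivative
    - sum_k chi_(l+k+1) tr(h_k X) at t = 0, where h_k = C A^k B and chi = det(s - A). So if the
    h_k (the odd ones in the Hamiltonian case) are linearly independent as functionals on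
    symmetric matrices, the derivative of F |-> phi_F at 0 is onto, and no nonzero polynomial
    vanishes on the image. By quantifier elimination the image or its complement contains the
    complement of a hypersurface, hence the image does. The independence is an open condition on
    Markov parameters; it holds for sum_i b_i b_i^T / (s - a_i), resp.
    sum_i b_i b_i^T / (s^2 - a_i), with distinct a_i and b_i among the e_p + e_q. *)

(** * Characteristic polynomials and adjugates *)

Section MatrixPolynomials.
Variable K : comNzRingType.

Lemma size_det_leq d (M : 'M[{poly K}]_d) :
  (forall i j, (size (M i j) <= 2)%N) -> (size (\det M) <= d.+1)%N.
Proof.
move=> sM; apply: leq_trans (size_sum _ _ _) _; apply/bigmax_leqP => s _.
rewrite size_Msign; apply: leq_trans (size_poly_prod_leq _ _) _.
rewrite leq_subLR addnS ltnS.
apply: (@leq_trans (\sum_(i < d) 2)); first by apply: leq_sum => i _; exact: sM.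
by rewrite sum_nat_const card_ord muln2 addnn.
Qed.

Lemma size_adj_char_poly_mx d (A : 'M[K]_d) i j :
  (size (\adj (char_poly_mx A) i j) <= d)%N.
Proof.
case: d A i j => [|d] A i j; first by case: i.
rewrite mxE /cofactor size_Msign; apply: size_det_leq => k l.
rewrite !mxE -polyCN; case: (_ == _); last first.
  by rewrite mulr0n add0r (leq_trans (size_polyC_leq1 _)).
by rewrite polyCN mulr1n size_XsubC.
Qed.

(* The coefficients of [adj (s - A)] follow Horner's scheme for [char_poly A]. *)
Lemma coef_adj_char_poly_mx d (A : 'M[K]_d) l :
  map_mx (fun p : {poly K} => p`_l) (\adj (char_poly_mx A)) =
  \sum_(k < d) (char_poly A)`_(l + k).+1 *: A ^+ k.
Proof.
pose N l := map_mx (fun p : {poly K} => p`_l) (\adj (char_poly_mx A)).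
have Nbig k : (d <= k)%N -> N k = 0.
  move=> dk; apply/matrixP => i j; rewrite [LHS]mxE [RHS]mxE nth_default //.
  exact: leq_trans (size_adj_char_poly_mx _ _ _) dk.
have NS k : N k = ((char_poly A)`_k.+1)%:M + A *m N k.+1.
  have := mul_mx_adj (char_poly_mx A); rewrite /N {N Nbig} -/(char_poly A).
  move: (\adj _) => N; rewrite mulmxBl mul_scalar_mx => /matrixP E.
  apply/matrixP => i j; have /polyP/(_ k.+1) := E i j.
  rewrite !mxE coefB coefXM /= coef_sum coefMn => /eqP.
  rewrite subr_eq => /eqP ->; congr (_ + _).
  by apply: eq_bigr => a _; rewrite !mxE coefCM.
rewrite -/(N l); case: d A N Nbig NS => [|d'] A N Nbig NS.
  by apply/matrixP => -[].
suff H m : N l = \sum_(k < m) (char_poly A)`_(l + k).+1 *: A ^+ k + A ^+ m *m N (l + m)%N.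
  by rewrite (H d'.+1) Nbig ?mulmx0 ?addr0 // leq_addl.
elim: m => [|m IH]; first by rewrite big_ord0 add0r expr0 mul1mx addn0.
rewrite IH big_ord_recr /= -addrA; congr (_ + _).
by rewrite NS mulmxDr mul_mx_scalar mulmxA exprSr addnS.
Qed.

(** Cayley-Hamilton as a linear recurrence with explicit coefficients, the form needed for powers of
    [A] and for Markov parameters; size 0 is treated apart. *)
Lemma char_poly_annihilates d (A : 'M[K]_d) :
  \sum_(i < d.+1) (char_poly A)`_i *: A ^+ i = 0.
Proof.
case: d A => [|d] A; first by apply/matrixP => -[].
have := Cayley_Hamilton A; rewrite -{1}[char_poly A]coefK poly_def size_char_poly.
rewrite rmorph_sum => CH; rewrite -[RHS]CH; apply: eq_bigr => i _.
by rewrite /= horner_mxZ rmorphXn /= horner_mx_X.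
Qed.

(** Determinants of [T (s - A) = (s - A') T] are compared over the polynomials, and [det T] is
    cancelled coefficient by coefficient, so its regularity is enough. *)
Lemma char_poly_conj d (A A' T : 'M[K]_d) :
  GRing.lreg (\det T) -> T *m A = A' *m T -> char_poly A = char_poly A'.
Proof.
move=> regT E; pose P := map_mx (@polyC K) T.
have: P *m char_poly_mx A = char_poly_mx A' *m P.
  by rewrite /char_poly_mx mulmxBr mulmxBl -!map_mxM E scalar_mxC.
move/(congr1 determinant); rewrite !det_mulmx [RHS]mulrC det_map_mx !mul_polyC => /polyP H.
by apply/polyP => i; have := H i; rewrite !coefZ => /regT.
Qed.

Lemma char_poly_tr d (A : 'M[K]_d) : char_poly A^T = char_poly A.
Proof.
rewrite /char_poly -[RHS]det_tr; congr (\det _).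
by apply/matrixP => i j; rewrite !mxE eq_sym.
Qed.

(** Compares coefficients in [chi_A(-s) = (-1)^d chi_(-A)(s)]. *)
Lemma coef_char_polyN d (A : 'M[K]_d) i :
  (char_poly (- A))`_i = (-1) ^+ (d + i) * (char_poly A)`_i.
Proof.
have E : char_poly A \Po (- 'X) = (-1) ^+ d *: char_poly (- A).
  rewrite /char_poly -mul_polyC rmorphXn rmorphN1 -detZ.
  rewrite -[LHS](det_map_mx (comp_poly (- 'X))); congr (\det _).
  apply/matrixP => a b; rewrite !mxE mulN1r rmorphB rmorphMn /=.
  by rewrite comp_polyC comp_polyX polyCN opprK opprD mulNrn.
have /polyP/(_ i) := E; rewrite coefZ -scaleN1r.
have -> : (char_poly A \Po (-1 *: 'X))`_i = (-1) ^+ i * (char_poly A)`_i.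
  rewrite comp_polyE coef_sum.
  under eq_bigr do rewrite exprZn coefZ coefZ coefXn.
  case: (ltnP i (size (char_poly A))) => si; last first.
    rewrite [_`_i]nth_default // mulr0 big1 // => k _.
    by rewrite (gtn_eqF (leq_trans (ltn_ord k) si)) !mulr0.
  rewrite (bigD1 (Ordinal si)) //= eqxx mulr1 big1 ?addr0 1?mulrC // => k.
  by rewrite -val_eqE /= eq_sym => /negPf ->; rewrite !mulr0.
by move/(congr1 (fun x => (-1) ^+ d * x)); rewrite signrMK mulrA -exprD.
Qed.

End MatrixPolynomials.

Lemma char_poly_even (K : numFieldType) d (A : 'M[K]_d) i :
  char_poly A = char_poly (- A) -> ~~ odd d -> odd i -> (char_poly A)`_i = 0.
Proof.
move=> /polyP/(_ i); rewrite (coef_char_polyN A); move: ((char_poly A)`_i) => c.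
rewrite -signr_odd oddD => E /negPf dE iE; move: E.
by rewrite dE iE expr1 mulN1r => /eqP; rewrite eq_sym eqNr => /eqP.
Qed.

(** * Transfer functions and their Markov parameters *)

Section TransferFunctions.
Variable R : realType.
Local Notation C := (R[i]).
Local Notation Cs := {fraction {poly C}}.
Local Notation mxF := (@mxF R _ _).
Implicit Types d n : nat.

Lemma cstF_zmod_morphism : zmod_morphism (@cstF R).
Proof. by move=> a b; rewrite /cstF polyCB tofracB. Qed.

Lemma cstF_monoid_morphism : monoid_morphism (@cstF R).
Proof. by split=> [|a b]; rewrite /cstF ?polyC1 ?tofrac1 // polyCM tofracM. Qed.

HB.instance Definition _ :=
  GRing.isZmodMorphism.Build C Cs (@cstF R) cstF_zmod_morphism.
HB.instance Definition _ :=
  GRing.isMonoidMorphism.Build C Cs (@cstF R) cstF_monoid_morphism.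

Lemma resolventE d (A : 'M[C]_d) :
  (sF R)%:M - mxF A = map_mx (@tofrac _) (char_poly_mx A).
Proof.
by apply/matrixP => i j; rewrite !mxE tofracB tofracMn.
Qed.

Lemma resolvent_unit d (A : 'M[C]_d) : (sF R)%:M - mxF A \in unitmx.
Proof.
rewrite resolventE unitmxE det_map_mx unitfE tofrac_eq0.
exact/monic_neq0/char_poly_monic.
Qed.

Lemma invmx_resolvent d (A : 'M[C]_d) :
  invmx ((sF R)%:M - mxF A) =
  (tofrac (char_poly A))^-1 *: map_mx (@tofrac _) (\adj (char_poly_mx A)).
Proof.
rewrite /invmx resolvent_unit; rewrite resolventE det_map_mx.
by rewrite map_mx_adj.
Qed.

(** Cramer's rule clears the denominator, which reduces identities between transfer functions to
    degrees and coefficients of polynomials. *)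
Lemma tf_numerator d n (A : 'M[C]_d) (B : 'M[C]_(d, n)) (Cm : 'M[C]_(n, d)) :
  tofrac (char_poly A) *: tf A B Cm =
  map_mx (@tofrac _) (map_mx polyC Cm *m \adj (char_poly_mx A) *m map_mx polyC B).
Proof.
rewrite /tf invmx_resolvent -scalemxAr -scalemxAl scalerA mulfV; last first.
  by rewrite tofrac_eq0; apply/monic_neq0/char_poly_monic.
by rewrite scale1r !map_mxM -!map_mx_comp.
Qed.

Lemma size_tf_numerator d n (A : 'M[C]_d) (B : 'M[C]_(d, n)) (Cm : 'M[C]_(n, d)) i j :
  (size ((map_mx polyC Cm *m \adj (char_poly_mx A) *m map_mx polyC B) i j) <= d)%N.
Proof.
rewrite mxE; apply: leq_trans (size_sum _ _ _) _; apply/bigmax_leqP => k _.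
rewrite [map_mx _ _ _ _]mxE mulrC mul_polyC.
apply: leq_trans (size_scale_leq _ _) _.
rewrite mxE; apply: leq_trans (size_sum _ _ _) _; apply/bigmax_leqP => l _.
rewrite [map_mx _ _ _ _]mxE mul_polyC.
apply: leq_trans (size_scale_leq _ _) _.
exact: size_adj_char_poly_mx.
Qed.

(** Once both denominators are cleared, the coefficient of [s^(d + d')] is [K i j] on one side and 0
    on the other. *)
Lemma tf_strictly_proper d d' n
    (A : 'M[C]_d) (B : 'M[C]_(d, n)) (Cm : 'M[C]_(n, d))
    (A' : 'M[C]_d') (B' : 'M[C]_(d', n)) (Cm' : 'M[C]_(n, d')) (K : 'M[C]_n) :
  mxF K = tf A B Cm - tf A' B' Cm' -> K = 0.
Proof.
move=> E; apply/matrixP => i j; rewrite [RHS]mxE.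
have := tf_numerator A B Cm; have := tf_numerator A' B' Cm'.
set N' := _ *m map_mx _ B'; set N := _ *m map_mx _ B => EN' EN.
have: (K i j)%:P * char_poly A * char_poly A' =
      N i j * char_poly A' - N' i j * char_poly A.
  apply/eqP; rewrite -tofrac_eq tofracB !tofracM.
  have /matrixP/(_ i j) := EN; rewrite !mxE => <-.
  have /matrixP/(_ i j) := EN'; rewrite !mxE => <-.
  have /matrixP/(_ i j) := E; rewrite !mxE /cstF => ->.
  by apply/eqP; ring.
move=> /(congr1 (fun p : {poly C} => p`_(d + d'))).
have sN : (size (N i j * char_poly A')%R <= d + d')%N.
  apply: leq_trans (size_polyMleq _ _) _; rewrite size_char_poly addnS /=.
  by rewrite leq_add2r; exact: size_tf_numerator.
have sN' : (size (N' i j * char_poly A)%R <= d + d')%N.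
  apply: leq_trans (size_polyMleq _ _) _; rewrite size_char_poly addnS /= addnC.
  by rewrite leq_add2l; exact: size_tf_numerator.
rewrite coefB [X in _ = X - _]nth_default // [X in _ = _ - X]nth_default // subrr.
rewrite -mulrA mul_polyC coefZ.
have mon : char_poly A * char_poly A' \is monic by rewrite monicMr ?char_poly_monic.
have sz : size (char_poly A * char_poly A') = (d + d').+1.
  rewrite size_monicM ?char_poly_monic ?monic_neq0 ?char_poly_monic //.
  by rewrite !size_char_poly addnS.
have := monicP mon; rewrite lead_coefE sz /= => ->.
by rewrite mulr1.
Qed.

Lemma tf_shift d n (A : 'M[C]_d) (B : 'M[C]_(d, n)) (Cm : 'M[C]_(n, d)) :
  sF R *: tf A B Cm = mxF (Cm *m B) + tf A B (Cm *m A).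
Proof.
have E : sF R *: invmx ((sF R)%:M - mxF A) =
         1%:M + mxF A *m invmx ((sF R)%:M - mxF A).
  apply/eqP; rewrite -subr_eq -mul_scalar_mx -mulmxBl mulmxV //.
  exact: resolvent_unit.
rewrite /tf scalemxAl scalemxAr.
by rewrite E mulmxDr mulmx1 mulmxDl /Defs.mxF !map_mxM !mulmxA.
Qed.

(** Expansion at infinity: multiplication by [s] splits off the constant [Cm *m B], which strict
    properness isolates, and leaves the transfer function with output [Cm *m A], to which the
    induction applies. *)
Lemma tf_markov d d' n
    (A : 'M[C]_d) (B : 'M[C]_(d, n)) (Cm : 'M[C]_(n, d))
    (A' : 'M[C]_d') (B' : 'M[C]_(d', n)) (Cm' : 'M[C]_(n, d')) :
  tf A B Cm = tf A' B' Cm' -> forall k, Cm *m A ^+ k *m B = Cm' *m A' ^+ k *m B'.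
Proof.
have swap (V : zmodType) (a b c e : V) : a + b = c + e -> c - a = b - e.
  by move=> E; apply/eqP; rewrite subr_eq addrAC [b + a]addrC E addrK.
move=> E k; elim: k Cm Cm' E => [|k IH] Cm Cm' E;
  have {E} := congr1 (fun M => sF R *: M) E; rewrite /= !tf_shift => /swap;
  rewrite /Defs.mxF -map_mxB => E; have K0 := tf_strictly_proper E.
  by rewrite !expr0 !mulmx1; apply/esym/eqP; rewrite -subr_eq0 K0.
rewrite !exprS !mulmxA; apply: IH; apply/eqP.
by rewrite -subr_eq0 -E K0 map_mx0.
Qed.

Lemma tf_tr d n (A : 'M[C]_d) (B : 'M[C]_(d, n)) (Cm : 'M[C]_(n, d)) :
  (tf A B Cm)^T = tf A^T Cm^T B^T.
Proof.
rewrite /tf !trmx_mul trmx_inv linearB /= tr_scalar_mx mulmxA /Defs.mxF.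
by rewrite !map_trmx.
Qed.

(** From [(s - A) T = T (s - A')] by inverting both resolvents. [T] may be rectangular, which serves
    both to shrink a realization and to embed it in a direct sum. *)
Lemma tf_intertwine d d' n
    (A : 'M[C]_d) (B : 'M[C]_(d, n)) (Cm : 'M[C]_(n, d))
    (A' : 'M[C]_d') (B' : 'M[C]_(d', n)) (Cm' : 'M[C]_(n, d')) (T : 'M[C]_(d, d')) :
  A *m T = T *m A' -> B = T *m B' -> Cm' = Cm *m T -> tf A B Cm = tf A' B' Cm'.
Proof.
move=> EA -> ->; rewrite /tf /Defs.mxF !map_mxM -!mulmxA; congr (_ *m _).
rewrite !mulmxA; congr (_ *m _).
have E : ((sF R)%:M - mxF A) *m mxF T = mxF T *m ((sF R)%:M - mxF A').
  by rewrite mulmxBl mulmxBr scalar_mxC /Defs.mxF -!map_mxM EA.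
apply: (can_inj (mulKmx (resolvent_unit A))).
by rewrite mulKVmx ?resolvent_unit // mulmxA E mulmxK ?resolvent_unit.
Qed.

(** Since [-s - A = -(s - (-A))], the substitution is again a realization once the outer sign is put
    on [Cm]. *)
Lemma tf_negE d n (A : 'M[C]_d) (B : 'M[C]_(d, n)) (Cm : 'M[C]_(n, d)) :
  tf_neg A B Cm = tf (- A) B (- Cm).
Proof.
rewrite /tf_neg /tf /Defs.mxF !map_mxN opprK.
have -> : (- sF R)%:M - map_mx (@cstF R) A = - 1 *: ((sF R)%:M + map_mx (@cstF R) A).
  by rewrite scaleN1r opprD raddfN.
have u : (sF R)%:M + map_mx (@cstF R) A \in unitmx.
  by have := resolvent_unit (- A); rewrite /Defs.mxF map_mxN opprK.
rewrite invmxZ ?unitrN1 ?unitmxZ ?unitrN1 // invrN1 scaleN1r.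
by rewrite mulmxN !mulNmx.
Qed.

End TransferFunctions.

(** * Reachability and observability over a field *)

Section Reachability.
Variable K : fieldType.
Implicit Types d n : nat.

(** Kalman's matrix [[B, A B, ..., A^(d-1) B]]. Observability is expressed as reachability of the
    pair [A^T], [Cm^T]. *)
Definition reach_mx d n (A : 'M[K]_d) (B : 'M[K]_(d, n)) :=
  \mxrow_(k < d) (A ^+ k *m B).

Lemma trmxX d (A : 'M[K]_d) k : A^T ^+ k = (A ^+ k)^T.
Proof.
elim: k => [|k IH]; first by rewrite !expr0 trmx1.
by rewrite exprS exprSr IH; exact/esym/trmx_mul.
Qed.

Lemma exprNmx d (A : 'M[K]_d) k : (- A) ^+ k = (-1) ^+ k *: A ^+ k.
Proof.
elim: k => [|k IH]; first by rewrite !expr0 scale1r.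
rewrite [LHS]exprS IH -[LHS]/(- A *m ((-1) ^+ k *: A ^+ k)) mulNmx -scalemxAr.
by rewrite [(-1) ^+ k.+1]exprS mulN1r scaleNr [A ^+ k.+1]exprS.
Qed.

Lemma tr_obs_block d n (A : 'M[K]_d) (Cm : 'M[K]_(n, d)) k :
  (A^T ^+ k *m Cm^T)^T = Cm *m A ^+ k.
Proof. by rewrite trmxX -trmx_mul trmxK. Qed.

Lemma tr_markov d n (A : 'M[K]_d) (B : 'M[K]_(d, n)) (Cm : 'M[K]_(n, d)) k :
  B^T *m A^T ^+ k *m Cm^T = (Cm *m A ^+ k *m B)^T.
Proof. by rewrite trmxX -!trmx_mul mulmxA. Qed.

Lemma mulmx_powS d n (A : 'M[K]_d) (B : 'M[K]_(d, n)) k :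
  A *m (A ^+ k *m B) = A ^+ k.+1 *m B.
Proof. by rewrite exprS mulmxA. Qed.

Lemma mulmx_expD d n (A : 'M[K]_d) (Cm : 'M[K]_(n, d)) k l :
  Cm *m A ^+ k *m A ^+ l = Cm *m A ^+ (k + l).
Proof. by rewrite exprD -[A ^+ k * _]/(A ^+ k *m _) mulmxA. Qed.

Lemma mulmx_powD d n (A : 'M[K]_d) (B : 'M[K]_(d, n)) (Cm : 'M[K]_(n, d)) k l :
  Cm *m A ^+ k *m (A ^+ l *m B) = Cm *m A ^+ (k + l) *m B.
Proof. by rewrite mulmxA mulmx_expD. Qed.

Lemma reach_mx_comb d n (A : 'M[K]_d) (B : 'M[K]_(d, n)) (c : 'I_d -> K) :
  reach_mx A B *m \mxcol_(j < d) (c j)%:M = \sum_(j < d) c j *: (A ^+ j *m B).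
Proof.
rewrite mul_mxrow_mxcol; apply: eq_bigr => j _.
by rewrite mul_mx_scalar.
Qed.

Lemma reach_mx_pow d n (A : 'M[K]_d) (B : 'M[K]_(d, n)) (k : 'I_d) :
  A ^+ k *m B = reach_mx A B *m \mxcol_(j < d) ((j == k)%:R)%:M.
Proof.
rewrite reach_mx_comb (bigD1 k) //= eqxx scale1r big1 ?addr0 // => j /negPf ->.
by rewrite scale0r.
Qed.

(** The column space is invariant under [A]: [Z] is a block companion matrix, which shifts the
    blocks and rewrites the overflowing power [A^d] by Cayley-Hamilton. *)
Lemma reach_mx_stable d n (A : 'M[K]_d) (B : 'M[K]_(d, n)) :
  exists Z, A *m reach_mx A B = reach_mx A B *m Z.
Proof.
pose c (k j : 'I_d) :=
  if (k.+1 < d)%N then (j == k.+1 :> nat)%:R else - (char_poly A)`_j.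
exists (\mxrow_(k < d) \mxcol_(j < d) (c k j)%:M).
rewrite [LHS]mul_mxrow [RHS]mul_mxrow; apply: eq_mxrow => k.
rewrite reach_mx_comb mulmx_powS /c.
case: ltnP => kd.
  rewrite (bigD1 (Ordinal kd)) //= eqxx scale1r big1 ?addr0 // => j.
  by rewrite -val_eqE /= => /negPf ->; rewrite scale0r.
have -> : k.+1 = d by apply/eqP; rewrite eqn_leq kd ltn_ord.
have := char_poly_annihilates A; rewrite big_ord_recr /=.
have -> : (char_poly A)`_d = 1.
  by have := monicP (char_poly_monic A); rewrite lead_coefE size_char_poly.
rewrite scale1r addrC => /eqP; rewrite addr_eq0 => /eqP ->.
rewrite mulNmx mulmx_suml -sumrN; apply: eq_bigr => j _.
by rewrite scaleNr scalemxAl.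
Qed.

Lemma reach_mx_cancel d n m (A : 'M[K]_d) (B : 'M[K]_(d, n)) (M M' : 'M[K]_(m, d)) :
  row_free (reach_mx A B) ->
  (forall k, M *m (A ^+ k *m B) = M' *m (A ^+ k *m B)) -> M = M'.
Proof.
move=> free E; apply: (row_free_inj free).
by rewrite !mul_mxrow; apply: eq_mxrow => k; exact: E.
Qed.

(** Equal Markov parameters give equal Hankel matrices (observability times reachability).
    Cancelling the second observability matrix yields a [T] that carries [A^k B] to [A'^k B']; the
    relations are then checked on these columns, which span. *)
Lemma realizations_similar d n
    (A A' : 'M[K]_d) (B B' : 'M[K]_(d, n)) (Cm Cm' : 'M[K]_(n, d)) :
  row_free (reach_mx A B) -> row_free (reach_mx A' B') ->
  row_free (reach_mx A'^T Cm'^T) ->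
  (forall k, Cm *m A ^+ k *m B = Cm' *m A' ^+ k *m B') ->
  exists T : 'M[K]_d,
    [/\ T \in unitmx, T *m A = A' *m T, T *m B = B' & Cm = Cm' *m T].
Proof.
move=> fR fR' fO' h.
have [T TE] : exists T : 'M[K]_d, forall k, T *m (A ^+ k *m B) = A' ^+ k *m B'.
  (* A left inverse of the second observability matrix, times the first one. *)
  exists ((pinvmx (reach_mx A'^T Cm'^T))^T *m (reach_mx A^T Cm^T)^T) => k.
  have PE : (reach_mx A^T Cm^T)^T *m (A ^+ k *m B) =
            (reach_mx A'^T Cm'^T)^T *m (A' ^+ k *m B').
    rewrite !tr_mxrow !mxcol_mul; apply: eq_mxcol => i.
    by rewrite !tr_obs_block !mulmx_powD h.
  by rewrite -mulmxA PE mulmxA -trmx_mul mulmxVp // trmx1 mul1mx.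
exists T; split.
- rewrite -row_free_unit -row_leq_rank.
  apply: (@leq_trans (\rank (reach_mx A' B'))); first by rewrite (eqP fR').
  have -> : reach_mx A' B' = T *m reach_mx A B.
    by rewrite mul_mxrow; apply: eq_mxrow => k; rewrite TE.
  exact: mxrankM_maxl.
- by apply: (reach_mx_cancel fR) => k; rewrite -!mulmxA mulmx_powS !TE mulmx_powS.
- by have := TE 0%N; rewrite !expr0 !mul1mx.
- by apply: (reach_mx_cancel fR) => k; rewrite -mulmxA TE !mulmxA h.
Qed.

End Reachability.

(** * Minimal realizations and the Hamiltonian duality *)

Section MinimalRealizations.
Variable R : realType.
Local Notation C := (R[i]).
Local Notation Cs := {fraction {poly C}}.
Implicit Types d n : nat.

(** Otherwise the restriction to the reachable space is a realization of smaller size. *)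
Lemma minimal_reach d n (A : 'M[C]_d) (B : 'M[C]_(d, n)) (Cm : 'M[C]_(n, d)) :
  mcmillan_degree (tf A B Cm) d -> row_free (reach_mx A B).
Proof.
case=> _ minG; apply/contraT; rewrite /row_free => neq.
have lt : (\rank (reach_mx A B) < d)%N by rewrite ltn_neqAle neq rank_leq_row.
case: (minG _ lt); have [Z EZ] := reach_mx_stable A B.
(* [P *m Q] is a rank factorization of the reachability matrix and [V] a right inverse of [Q]; in
   the basis [P] the restriction of [A] is [Q *m Z *m V]. *)
move: (col_base _) (row_base _) (mulmx_base (reach_mx A B)) (row_base_free (reach_mx A B)).
move: (\rank _) lt => r lt P Q EPQ freeQ.
move: (pinvmx Q) (mulmxVp freeQ) => V QV.
(* [r < d] makes [d] positive, so the block of index 0, which is [B] itself, exists. *)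
pose k0 := Ordinal (leq_ltn_trans (leq0n r) lt).
exists (Q *m Z *m V), (Q *m \mxcol_(j < d) ((j == k0)%:R)%:M), (Cm *m P).
apply/esym/(@tf_intertwine _ _ _ _ _ _ _ _ _ _ P) => //.
  by rewrite !mulmxA EPQ -EZ -EPQ mulmxA -[RHS]mulmxA QV mulmx1.
by rewrite mulmxA EPQ -(reach_mx_pow A B k0) expr0 mul1mx.
Qed.

(** Transposition exchanges observability with reachability and preserves the McMillan degree. *)
Lemma minimal_obs d n (A : 'M[C]_d) (B : 'M[C]_(d, n)) (Cm : 'M[C]_(n, d)) :
  mcmillan_degree (tf A B Cm) d -> row_free (reach_mx A^T Cm^T).
Proof.
case=> real minG; apply: (@minimal_reach d n _ _ B^T); rewrite -tf_tr; split.
  by exists A^T, Cm^T, B^T; rewrite -tf_tr.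
move=> k kd [A1 [B1 [C1 E]]]; apply: (minG k kd).
by exists A1^T, C1^T, B1^T; rewrite -tf_tr E trmxK.
Qed.

(* The state-space isomorphism theorem *)
Lemma minimal_realizations_similar d n
    (A A' : 'M[C]_d) (B B' : 'M[C]_(d, n)) (Cm Cm' : 'M[C]_(n, d)) :
  mcmillan_degree (tf A B Cm) d -> tf A B Cm = tf A' B' Cm' ->
  exists T : 'M[C]_d,
    [/\ T \in unitmx, T *m A = A' *m T, T *m B = B' & Cm = Cm' *m T].
Proof.
move=> minG E; apply: realizations_similar (tf_markov E).
- exact: minimal_reach minG.
- by apply: (minimal_reach (Cm := Cm')); rewrite -E.
- by apply: (minimal_obs (B := B')); rewrite -E.
Qed.

Lemma cl_charpoly_realization d n
    (A A' : 'M[C]_d) (B B' : 'M[C]_(d, n)) (Cm Cm' : 'M[C]_(n, d)) F :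
  mcmillan_degree (tf A B Cm) d -> tf A B Cm = tf A' B' Cm' ->
  cl_charpoly A B Cm F = cl_charpoly A' B' Cm' F.
Proof.
move=> minG /(minimal_realizations_similar minG) [T [uT EA EB EC]].
apply: (char_poly_conj (T := T)).
  by apply/lregP; rewrite -unitfE -unitmxE.
by rewrite mulmxDr mulmxDl EA EC !mulmxA EB.
Qed.

Lemma tfB d n (A : 'M[C]_d) (B : 'M[C]_(d, n)) (Cm Cm' : 'M[C]_(n, d)) :
  tf A B (Cm - Cm') = tf A B Cm - tf A B Cm'.
Proof. by rewrite /tf /mxF map_mxB !mulmxBl. Qed.

(** Both systems sit in one direct sum with different output matrices. The difference of the outputs
    has zero Markov parameters, and the coefficients of its numerator are combinations of these by
    [coef_adj_char_poly_mx]. *)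
Lemma markov_tf d d' n
    (A : 'M[C]_d) (B : 'M[C]_(d, n)) (Cm : 'M[C]_(n, d))
    (A' : 'M[C]_d') (B' : 'M[C]_(d', n)) (Cm' : 'M[C]_(n, d')) :
  (forall k, Cm *m A ^+ k *m B = Cm' *m A' ^+ k *m B') ->
  tf A B Cm = tf A' B' Cm'.
Proof.
move=> h; pose A2 := block_mx A 0 0 A'; pose B2 := col_mx B B'.
have E : tf A B Cm = tf A2 B2 (row_mx Cm 0).
  apply: (@tf_intertwine _ _ _ _ _ _ _ _ _ _ (row_mx 1%:M 0)).
  - by rewrite mul_mx_row mul_row_block !mul1mx !mul0mx mulmx1 mulmx0 !addr0.
  - by rewrite mul_row_col mul1mx mul0mx addr0.
  - by rewrite mul_mx_row mulmx1 mulmx0.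
have E' : tf A' B' Cm' = tf A2 B2 (row_mx 0 Cm').
  apply: (@tf_intertwine _ _ _ _ _ _ _ _ _ _ (row_mx 0 1%:M)).
  - by rewrite mul_mx_row mul_row_block !mul1mx !mul0mx mulmx1 mulmx0 !add0r.
  - by rewrite mul_row_col mul1mx mul0mx add0r.
  - by rewrite mul_mx_row mulmx1 mulmx0.
apply/eqP; rewrite -subr_eq0 E E' -tfB.
set C2 := _ - _; have h0 k : C2 *m A2 ^+ k *m B2 = 0.
  by rewrite !mulmxBl -(tf_markov E) -(tf_markov E') h subrr.
have nz : tofrac (char_poly A2) != 0.
  by rewrite tofrac_eq0; apply/monic_neq0/char_poly_monic.
rewrite -(inj_eq (scalerI nz)) scaler0 tf_numerator.
suff -> : map_mx polyC C2 *m \adj (char_poly_mx A2) *m map_mx polyC B2 = 0.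
  by rewrite map_mx0.
have coefE l : map_mx (fun p : {poly C} => p`_l)
    (map_mx polyC C2 *m \adj (char_poly_mx A2) *m map_mx polyC B2) =
    C2 *m map_mx (fun p : {poly C} => p`_l) (\adj (char_poly_mx A2)) *m B2.
  apply/matrixP => i j; move: (\adj _) => M; rewrite !mxE coef_sum.
  apply: eq_bigr => a _; rewrite !mxE coefMC coef_sum; congr (_ * _).
  by apply: eq_bigr => b _; rewrite !mxE coefCM.
apply/matrixP => i j; apply/polyP => l.
have -> : (0 : 'M[{poly C}]_n) i j = 0 by rewrite mxE.
rewrite coef0.
have /matrixP/(_ i j) := coefE l; rewrite [LHS]mxE => ->.
rewrite coef_adj_char_poly_mx mulmx_sumr mulmx_suml summxE big1 // => k _.
by rewrite -scalemxAr -scalemxAl h0 scaler0 mxE.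
Qed.

Lemma markovN d n (A : 'M[C]_d) (B : 'M[C]_(d, n)) (Cm : 'M[C]_(n, d)) k :
  - Cm *m (- A) ^+ k *m B = (-1) ^+ k.+1 *: (Cm *m A ^+ k *m B).
Proof.
by rewrite exprNmx !mulNmx -scalemxAr -scalemxAl exprS mulN1r scaleNr.
Qed.

Lemma tf_neg_tr d n (A : 'M[C]_d) (B : 'M[C]_(d, n)) (Cm : 'M[C]_(n, d)) :
  (tf_neg A B Cm)^T = tf (- A)^T (- Cm)^T B^T.
Proof.
by rewrite tf_negE tf_tr.
Qed.

(** [hamiltonian_tf] provides one realization, perhaps of another size; equality of Markov
    parameters transfers its property to the given one. *)
Lemma hamiltonian_dual d n G (A : 'M[C]_d) (B : 'M[C]_(d, n)) (Cm : 'M[C]_(n, d)) :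
  hamiltonian_tf G -> tf A B Cm = G -> tf (- A)^T (- Cm)^T B^T = G.
Proof.
case=> d1 [A1 [B1 [C1 [E1 E2]]]] E; rewrite -E2 -tf_neg_tr !tf_negE.
congr (_^T); apply: markov_tf => k; rewrite !markovN.
by rewrite (@tf_markov _ _ _ _ A B Cm A1 B1 C1) // E E1.
Qed.

(** Closing the loop on the dual realization gives the transpose of [-(A + B F C)], because [F] is
    symmetric. *)
Lemma hamiltonian_cl_charpoly_even m n G
    (A : 'M[C]_(2 * m)) (B : 'M[C]_(2 * m, n)) (Cm : 'M[C]_(n, 2 * m)) (F : 'M[C]_n) i :
  Ham (2 * m) G -> tf A B Cm = G -> F^T = F -> odd i ->
  (cl_charpoly A B Cm F)`_i = 0.
Proof.
case=> minG hamG E symF oddi; have dual := hamiltonian_dual hamG E.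
rewrite /cl_charpoly; apply: char_poly_even; [| by rewrite oddM | exact: oddi].
rewrite -/(cl_charpoly A B Cm F).
transitivity (cl_charpoly (- A)^T (- Cm)^T B^T F).
  by apply: cl_charpoly_realization; rewrite E.
rewrite /cl_charpoly -[RHS]char_poly_tr; congr char_poly.
by rewrite opprD -mulmxN [RHS]raddfD /= !trmx_mul symF mulmxA.
Qed.

End MinimalRealizations.

(** * Polynomial functions over an algebraically closed field *)

Lemma digits_inj D n (f g : nat -> nat) :
  (forall i, (i < n)%N -> (f i < D)%N) -> (forall i, (i < n)%N -> (g i < D)%N) ->
  (\sum_(i < n) f i * D ^ i = \sum_(i < n) g i * D ^ i)%N ->
  forall i, (i < n)%N -> f i = g i.
Proof.
elim: n f g => // n IH f g fD gD; rewrite !big_ord_recl /= !expn0 !muln1.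
have shift (h : nat -> nat) :
    (\sum_(i < n) h (bump 0 i) * D ^ bump 0 i = (\sum_(i < n) h i.+1 * D ^ i) * D)%N.
  rewrite big_distrl; apply: eq_bigr => i _.
  by rewrite /bump /= add1n expnSr mulnA.
rewrite !shift => E.
have D0 : (0 < D)%N by apply: leq_ltn_trans (fD 0 _).
have E0 : f 0 = g 0.
  by have := congr1 (modn^~ D) E; rewrite /= ![(_ + _ * D)%N]addnC !modnMDl !modn_small ?fD ?gD.
move: E; rewrite E0 => /addnI /eqP; rewrite eqn_pmul2r // => /eqP E.
case=> // i lt_i; apply: (IH (f \o succn) (g \o succn)) => // j lt_j; [exact: fD|exact: gD].
Qed.

Section ClosedFieldPolynomials.
Variable K : closedFieldType.

Lemma meval_horner n (p : {mpoly K[n]}) (g : 'I_n -> {poly K}) t :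
  (mmap (@polyC K) g p).[t] = p.@[fun i => (g i).[t]].
Proof.
rewrite mevalE /mmap horner_sum; apply: eq_bigr => m _.
rewrite hornerM hornerC horner_prod; congr (_ * _).
by apply: eq_bigr => i _; rewrite horner_exp.
Qed.

Lemma poly_vanishing (p : {poly K}) : (forall t, p.[t] = 0) -> p = 0.
Proof.
move=> p0; apply/eqP/negPn/negP => /closed_nonrootP [x].
by rewrite rootE p0 eqxx.
Qed.

(* Kronecker substitution: distinct monomials become distinct powers of one variable. *)
Lemma mpoly_vanishing n (p : {mpoly K[n]}) : (forall x, p.@[x] = 0) -> p = 0.
Proof.
(* All exponents in [p] are less than [D], so they are the base [D] digits of [e m]. *)
move=> p0; pose D := msize p; pose e (m : 'X_{1..n}) := (\sum_(i < n) m i * D ^ i)%N.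
have P0 : mmap (@polyC K) (fun i : 'I_n => 'X^(D ^ i)) p = 0.
  by apply: poly_vanishing => t; rewrite meval_horner p0.
have PE : mmap (@polyC K) (fun i : 'I_n => 'X^(D ^ i)) p =
          \sum_(m <- msupp p) p@_m *: 'X^(e m).
  rewrite /mmap; apply: eq_bigr => m _; rewrite mul_polyC; congr (_ *: _).
  rewrite /mmap1 /e; under eq_bigr => i _ do rewrite -exprM mulnC.
  by rewrite prodrXr.
have e_inj m m' : m \in msupp p -> m' \in msupp p -> e m = e m' -> m = m'.
  have ltD (q : 'X_{1..n}) (i : 'I_n) : q \in msupp p -> (q i < D)%N.
    move=> /msize_mdeg_lt; apply: leq_ltn_trans.
    by rewrite mdegE (bigD1 i) //= leq_addr.
  move=> mp mp' E; apply/mnmP => i.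
  pose f (q : 'X_{1..n}) k := oapp q 0%N (insub k : option 'I_n).
  have fE q (j : 'I_n) : f q j = q j by rewrite /f valK.
  rewrite -!fE; apply: (@digits_inj D n) => // [k lk|k lk|].
  - by rewrite -[k]/(val (Ordinal lk)) fE ltD.
  - by rewrite -[k]/(val (Ordinal lk)) fE ltD.
  - by under eq_bigr do rewrite fE; under [RHS]eq_bigr do rewrite fE.
apply/mpolyP => m; rewrite mcoeff0.
case: (boolP (m \in msupp p)) => [mp|]; last exact: memN_msupp_eq0.
have := congr1 (fun q : {poly K} => q`_(e m)) P0.
rewrite PE coef_sum coef0 (bigD1_seq m) ?msupp_uniq //= coefZ coefXn eqxx mulr1.
rewrite big_seq_cond big1 ?addr0 // => m' /andP[mp' ne].
rewrite coefZ coefXn; case: eqP => [E|]; last by rewrite mulr0.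
by rewrite (e_inj _ _ mp mp' E) eqxx in ne.
Qed.

(* If curves through one point with every tangent direction lie in [q = 0], then the lowest
   homogeneous component of [q] at that point vanishes identically. *)
Lemma mpoly_tangent_vanishing m (q : {mpoly K[m]}) (c0 : 'I_m -> K) :
  (forall y : 'I_m -> K, exists g : 'I_m -> {poly K},
     (forall j, (g j)`_0 = c0 j /\ (g j)`_1 = y j) /\
     (forall t, q.@[fun j => (g j).[t]] = 0)) ->
  q = 0.
Proof.
move=> tangent.
pose q' := comp_mpoly [tuple 'X_i + (c0 i)%:MP | i < m] q.
have q'E z : q'.@[z] = q.@[fun i => z i + c0 i].
  rewrite comp_mpoly_meval; apply: meval_eq => i.
  by rewrite tnth_mktuple mevalD mevalXU mevalC.
suff q'0 : q' = 0.
  apply: mpoly_vanishing => x; transitivity q'.@[fun i => x i - c0 i]; last by rewrite q'0 meval0.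
  rewrite q'E.
  by apply: meval_eq => i; rewrite subrK.
apply/eqP/negPn/negP => nz.
have ex : exists k, has (fun e => mdeg e == k) (msupp q').
  by exists (mdeg (mlead q')); apply/hasP; exists (mlead q'); rewrite ?mlead_supp.
case: (ex_minnP ex) => k /hasP[m0 m0q /eqP dm0] kmin.
pose qk : {mpoly K[m]} := \sum_(e <- msupp q' | mdeg e == k) q'@_e *: 'X_[e].
suff qk0 : qk = 0.
  have := congr1 (fun r : {mpoly K[m]} => r@_m0) qk0.
  rewrite mcoeff0 raddf_sum /= big_mkcond (bigD1_seq m0) ?msupp_uniq //= dm0 eqxx.
  rewrite mcoeffZ mcoeffX eqxx mulr1 big1 ?addr0 => [/eqP|e /negPf ne].
    by rewrite mcoeff_eq0 m0q.
  by case: ifP => // _; rewrite mcoeffZ mcoeffX ne mulr0.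
apply: mpoly_vanishing => y; have [g [gE gq]] := tangent y.
pose h j := \poly_(i < size (g j)) (g j)`_i.+1.
have hE j : g j = h j * 'X + (c0 j)%:P.
  apply/polyP => -[|i]; rewrite coefD coefMX coefC /= ?add0r ?addr0.
    by case: (gE j).
  by rewrite coef_poly; case: ltnP => // le; rewrite nth_default // ltnW.
have h0 j : (h j).[0] = y j.
  rewrite horner_coef0 coef_poly; case: ltnP => [_|le]; first by case: (gE j).
  by case: (gE j) => _ <-; rewrite nth_default // ltnW.
have P0 : mmap (@polyC K) (fun j => h j * 'X) q' = 0.
  apply: poly_vanishing => t; rewrite meval_horner q'E -[RHS](gq t).
  by apply: meval_eq => j; rewrite [in RHS]hE hornerD hornerC.
(* Along the curve a monomial of degree [a] is divisible by [t^a], so the coefficient of [t^k] only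
   sees [qk], evaluated at the tangent [h(0) = y]. *)
have := congr1 (fun r : {poly K} => r`_k) P0; rewrite coef0 => <-.
rewrite /mmap coef_sum /qk raddf_sum /= big_mkcond big_seq [RHS]big_seq.
apply: eq_bigr => e eq'.
have -> : mmap1 (fun j => h j * 'X) e = (\prod_j h j ^+ e j) * 'X^(mdeg e).
  rewrite mdegE -prodrXr -big_split; apply: eq_bigr => j _.
  exact: exprMn.
have kle : (k <= mdeg e)%N by apply: kmin; apply/hasP; exists e.
rewrite mulrA coefMXn; case: eqP => [->|ne]; last first.
  by rewrite ltn_neqAle kle andbT eq_sym; move/eqP: ne => ->.
rewrite ltnn subnn coefCM -horner_coef0 horner_prod mevalZ mevalX; congr (_ * _).
by apply: eq_bigr => j _; rewrite horner_exp h0.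
Qed.

Lemma rterm_mpoly m (t : GRing.term K) : GRing.rterm t ->
  exists p : {mpoly K[m]}, forall c : 'I_m -> K,
    GRing.eval [tuple c i | i < m] t = p.@[c].
Proof.
elim: t => /=.
- move=> k _; case: (ltnP k m) => km.
    exists 'X_(Ordinal km) => c.
    by rewrite mevalXU; exact: (nth_mktuple c 0 (Ordinal km)).
  (* A variable beyond the tuple takes the default value 0. *)
  by exists 0 => c; rewrite meval0 nth_default // size_map size_enum_ord.
- by move=> a _; exists a%:MP => c; rewrite mevalC.
- by move=> a _; exists (a%:R) => c; rewrite rmorph_nat.
- move=> t1 IH1 t2 IH2 /andP[/IH1[p1 E1] /IH2[p2 E2]].
  by exists (p1 + p2) => c; rewrite mevalD E1 E2.
- by move=> t1 IH1 /IH1[p1 E1]; exists (- p1) => c; rewrite mevalN E1.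
- by move=> t1 IH1 a /IH1[p1 E1]; exists (p1 *+ a) => c; rewrite mevalMn E1.
- move=> t1 IH1 t2 IH2 /andP[/IH1[p1 E1] /IH2[p2 E2]].
  by exists (p1 * p2) => c; rewrite mevalM E1 E2.
- by [].
- by move=> t1 IH1 a /IH1[p1 E1]; exists (p1 ^+ a) => c; rewrite rmorphXn /= E1.
Qed.

(** The unknowns are numbered from [m] on because the variables below [m] will hold the target
    values. *)
Lemma mpoly_rterm n (p : {mpoly K[n]}) m :
  exists t : GRing.term K, GRing.rterm t /\
    forall e, GRing.eval e t = p.@[fun i : 'I_n => e`_(m + i)].
Proof.
elim/mpolyind: p => [|a e p _ _ [t [rt tE]]].
  by exists (GRing.Const 0); split=> // e; rewrite meval0.
have [u [ru uE]] : exists u : GRing.term K, GRing.rterm u /\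
    forall s, GRing.eval s u = \prod_(i < n) s`_(m + i) ^+ e i.
  elim: (index_enum _) => [|i r [u [ru uE]]].
    by exists (GRing.Const 1); split=> // s; rewrite big_nil.
  exists (GRing.Mul (GRing.Exp (GRing.Var _ (m + i)%N) (e i)) u); split=> // s.
  by rewrite big_cons /= uE.
exists (GRing.Add (GRing.Mul (GRing.Const a) u) t); split; first by rewrite /= ru rt.
by move=> s; rewrite /= uE tE mevalD mevalZ mevalX.
Qed.

(** An equation between distinct polynomials fails off the zero set of their difference; binary
    connectives multiply the exceptional polynomials. *)
Lemma qf_form_generic m (f : GRing.formula K) : GRing.qf_form f && GRing.rformula f ->
  exists2 q : {mpoly K[m]}, q != 0 &
  exists b, forall c : 'I_m -> K, q.@[c] != 0 -> GRing.qf_eval [tuple c i | i < m] f = b.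
Proof.
have two f1 f2 (op : bool -> bool -> bool) :
  (exists2 q : {mpoly K[m]}, q != 0 & exists b, forall c : 'I_m -> K,
     q.@[c] != 0 -> GRing.qf_eval [tuple c i | i < m] f1 = b) ->
  (exists2 q : {mpoly K[m]}, q != 0 & exists b, forall c : 'I_m -> K,
     q.@[c] != 0 -> GRing.qf_eval [tuple c i | i < m] f2 = b) ->
  (exists2 q : {mpoly K[m]}, q != 0 & exists b, forall c : 'I_m -> K,
     q.@[c] != 0 -> op (GRing.qf_eval [tuple c i | i < m] f1)
                       (GRing.qf_eval [tuple c i | i < m] f2) = b).
  move=> [q1 n1 [b1 E1]] [q2 n2 [b2 E2]]; exists (q1 * q2); first by rewrite mulf_neq0.
  exists (op b1 b2) => c; rewrite mevalM mulf_eq0 negb_or => /andP[/E1 -> /E2 ->].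
  by [].
elim: f => //=.
- by move=> b _; exists 1; [exact: oner_neq0 | exists b].
- move=> t1 t2 /andP[/(rterm_mpoly m)[p1 E1] /(rterm_mpoly m)[p2 E2]].
  have [E|ne] := eqVneq p1 p2.
    by exists 1; [exact: oner_neq0 | exists true => c _; rewrite E1 E2 E eqxx].
  exists (p1 - p2); first by rewrite subr_eq0.
  exists false => c; rewrite mevalB subr_eq0 => /negPf.
  by rewrite E1 E2.
- move=> f1 IH1 f2 IH2; rewrite andbACA => /andP[/IH1 H1 /IH2 H2].
  exact: (two _ _ andb).
- move=> f1 IH1 f2 IH2; rewrite andbACA => /andP[/IH1 H1 /IH2 H2].
  exact: (two _ _ orb).
- move=> f1 IH1 f2 IH2; rewrite andbACA => /andP[/IH1 H1 /IH2 H2].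
  exact: (two _ _ implb).
- move=> f1 IH1 /IH1[q nq [b E]]; exists q => //.
  by exists (~~ b) => c /E ->.
Qed.

(* A weak form of Chevalley's theorem, by quantifier elimination. *)
Lemma polynomial_image_generic n m (f : 'I_m -> {mpoly K[n]}) :
  exists2 q : {mpoly K[m]}, q != 0 &
    (forall c, q.@[c] != 0 -> exists x, forall j, (f j).@[x] = c j) \/
    (forall x, q.@[fun j => (f j).@[x]] = 0).
Proof.
have /fin_all_exists [t tP] := fun j => mpoly_rterm (f j) m.
pose body := foldr (@GRing.And K) (GRing.Bool true)
  [seq GRing.Equal (t j) (GRing.Var _ (j : nat)) | j <- enum 'I_m].
have body_r : GRing.rformula body.
  rewrite /body; elim: (enum _) => //= j s ->; rewrite andbT.
  by case: (tP j) => ->.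
have bodyP e : GRing.holds e body <-> forall j : 'I_m, (f j).@[fun i => e`_(m + i)] = e`_j.
  rewrite (_ : (forall j : 'I_m, _) <->
     (forall j, j \in enum 'I_m -> (f j).@[fun i => e`_(m + i)] = e`_j)).
    rewrite /body; elim: (enum _) => [|j s IH] /=; first by split.
    rewrite IH (tP j).2; split=> [[E H] i|H].
      by rewrite inE => /orP[/eqP -> //|]; exact: H.
    split; first by apply: H; rewrite mem_head.
    by move=> i si; apply: H; rewrite inE si orbT.
  split=> H j; first by move=> _; exact: H.
  by apply: H; rewrite mem_enum.
(* The [n] coordinates of the point are quantified away; the target [c] stays free. *)
pose phi := foldr (@GRing.Exists K) body (iota m n).
have phi_r : GRing.rformula phi by rewrite /phi; elim: (iota _ _).
have wf := @ClosedFieldQE.wf_ex_elim K.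
have ok := ClosedFieldQE.holds_ex_elim (@solve_monicpoly K).
have := GRing.quantifier_elim_wf wf phi_r.
set psi := GRing.quantifier_elim _ _ => /(qf_form_generic m)[q nq [b qE]].
exists q => //.
have phiP (c : 'I_m -> K) : reflect (exists x, forall j, (f j).@[x] = c j)
    (GRing.qf_eval [tuple c i | i < m] psi).
  apply: (iffP (GRing.quantifier_elim_rformP wf ok _ phi_r)).
    move=> /GRing.foldExistsP [e eqe /bodyP H].
    exists (fun i => e`_(m + i)) => j; rewrite H -eqe ?inE ?mem_iota.
      exact: nth_mktuple.
    by rewrite leqNgt ltn_ord.
  move=> [x xE]; apply/GRing.foldExistsP.
  exists ([tuple c i | i < m] ++ [tuple x i | i < n]).
    move=> k; rewrite inE mem_iota negb_and -ltnNge -leqNgt => /orP[lt|le].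
      by rewrite nth_cat size_tuple lt.
    rewrite nth_default ?size_tuple ?nth_default // ?size_cat ?size_tuple //.
    exact: leq_trans (leq_addr _ _) le.
  apply/bodyP => j; rewrite nth_cat size_tuple ltn_ord nth_mktuple -xE.
  apply: meval_eq => i; rewrite nth_cat size_tuple ltnNge leq_addr addKn.
  by rewrite nth_mktuple.
(* The generic truth value of the quantifier-free equivalent selects the alternative. *)
case: b qE => qE; [left|right] => [c /qE/phiP //|x].
apply/eqP/negPn/negP => /qE /negP; case; apply/phiP; by exists x.
Qed.

(** The image contains curves through [c0] in every tangent direction, so no nonzero polynomial
    vanishes on it, which leaves the first alternative of [polynomial_image_generic]. *)
Lemma polynomial_image_open n m (f : 'I_m -> {mpoly K[n]}) (c0 : 'I_m -> K) :
  (forall y : 'I_m -> K, exists x : 'I_n -> {poly K},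
     forall j, let g := mmap (@polyC K) x (f j) in g`_0 = c0 j /\ g`_1 = y j) ->
  exists2 q : {mpoly K[m]}, q != 0 &
    forall c, q.@[c] != 0 -> exists x, forall j, (f j).@[x] = c j.
Proof.
move=> tangent; have [q nq [qE|q0]] := polynomial_image_generic f; first by exists q.
case/negP: nq; apply/eqP; apply: (@mpoly_tangent_vanishing _ _ c0) => y.
have [x xE] := tangent y; exists (fun j => mmap (@polyC K) x (f j)); split=> // t.
rewrite -[RHS](q0 (fun i => (x i).[t])).
by apply: meval_eq => j; rewrite meval_horner.
Qed.

End ClosedFieldPolynomials.

(** * Algebraic dependence by a dimension count *)

Section AlgebraicDependence.
Variables (K : fieldType) (n : nat).
Implicit Types p q : {mpoly K[n]}.

(** Unlike [msize], which is off by one from the degree, these bounds simply add up under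
    products. *)
Definition mdeg_le p a := forall m, m \in msupp p -> (mdeg m <= a)%N.

Lemma mdeg_le_weaken p a b : (a <= b)%N -> mdeg_le p a -> mdeg_le p b.
Proof. by move=> ab H m /H /leq_trans; apply. Qed.

Lemma mdeg_leM p q a b : mdeg_le p a -> mdeg_le q b -> mdeg_le (p * q) (a + b).
Proof.
move=> Hp Hq m /msuppM_le /allpairsP [[m1 m2] /= [/Hp H1 /Hq H2 ->]].
by rewrite mdegD leq_add.
Qed.

Lemma mdeg_le1 : mdeg_le 1 0.
Proof. by move=> m; rewrite msupp1 inE => /eqP ->; rewrite mdeg0. Qed.

Lemma mdeg_leX p a k : mdeg_le p a -> mdeg_le (p ^+ k) (k * a).
Proof.
move=> Hp; elim: k => [|k IH]; first by rewrite expr0; exact: mdeg_le1.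
by rewrite exprS mulSn; apply: mdeg_leM.
Qed.

Lemma mdeg_le_prod (I : finType) (F : I -> {mpoly K[n]}) a :
  (forall i, mdeg_le (F i) a) -> mdeg_le (\prod_i F i) (#|I| * a).
Proof.
move=> HF; rewrite -sum_nat_const; elim/big_rec2: _ => [|i b p _ Hp]; first exact: mdeg_le1.
exact: mdeg_leM.
Qed.

(* Count: the k ^ d monomials of degree < k in each variable are sent to polynomials of degree
   O(k) in n < d variables. *)
Lemma algebraic_dependence d (f : 'I_d -> {mpoly K[n]}) : (n < d)%N ->
  exists2 q : {mpoly K[d]}, q != 0 & forall x, q.@[fun j => (f j).@[x]] = 0.
Proof.
have leX a c e : (a <= c)%N -> (a ^ e <= c ^ e)%N by case: e => // e; rewrite leq_exp2r.
move=> nd; pose D := \max_j msize (f j).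
(* Chosen so that [b <= k * (d * D + 1)], hence [b ^ n <= k ^ n * (d * D + 1) ^ n < k ^ (n + 1) <= k
   ^ d]. *)
pose k := ((d * D).+1 ^ n).+1; pose b := (d * (k * D)).+1.
pose T := {ffun 'I_d -> 'I_k}.
pose fe (e : T) := \prod_j f j ^+ e j.
have fe_deg e m : m \in msupp (fe e) -> (mdeg m < b)%N.
  rewrite /b ltnS -[X in (_ <= X * _)%N]card_ord; apply: mdeg_le_prod => j.
  apply: (@mdeg_le_weaken _ (e j * D)); first by rewrite leq_mul2r (ltnW (ltn_ord _)) orbT.
  apply: mdeg_leX => m' /msize_mdeg_lt /ltnW /leq_trans; apply.
  exact: (leq_bigmax j).
pose B := 'X_{1..n < b}.
have cardB : (#|{: B}| <= b ^ n)%N.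
  pose g (m : B) : {ffun 'I_n -> 'I_b} := [ffun i => inord (m i)].
  have g_inj : injective g.
    move=> m1 m2 /ffunP E; apply/val_inj/mnmP => i; have := congr1 (@nat_of_ord _) (E i).
    have lt (m : B) : (m i < b)%N.
      by apply: leq_ltn_trans (bmdeg m); rewrite mdegE (bigD1 i) //= leq_addr.
    by rewrite !ffunE !inordK ?lt.
  by have := leq_card g g_inj; rewrite card_ffun !card_ord.
have cardT : #|{: T}| = (k ^ d)%N by rewrite card_ffun !card_ord.
have lt : (#|{: B}| < #|{: T}|)%N.
  rewrite cardT; apply: (leq_ltn_trans cardB).
  apply: (@leq_ltn_trans ((k * (d * D).+1) ^ n)).
    by apply: leX; rewrite /b mulnS; lia.
  rewrite expnMn; apply: (@leq_trans (k ^ n.+1)); last by rewrite leq_pexp2l.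
  by rewrite expnSr ltn_pmul2l ?expn_gt0.
(* Each row lists the coefficients of one product of the [f j]; with more rows than columns, a
   nonzero vector of the left kernel is the desired relation. *)
pose M : 'M[K]_(#|{: T}|, #|{: B}|) := 
  \matrix_(i, j) (fe (enum_val i))@_(enum_val j : B).
have : kermx M != 0.
  rewrite kermx_eq0 /row_free neq_ltn; apply/orP; left.
  exact: leq_ltn_trans (rank_leq_col _) lt.
case/rowV0Pn=> v; rewrite sub_kermx => /eqP vM vn0.
pose mn (e : T) := [multinom (e j : nat) | j < d].
have mn_inj : injective mn.
  move=> e1 e2 /mnmP E; apply/ffunP => j; apply: val_inj.
  by have := E j; rewrite !mnmE.
pose q : {mpoly K[d]} := \sum_i v 0 i *: 'X_[mn (enum_val i)].
exists q.
  apply: contraNneq vn0 => q0; apply/eqP/rowP => i; rewrite mxE.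
  have := congr1 (fun r : {mpoly K[d]} => r@_(mn (enum_val i))) q0.
  rewrite mcoeff0 raddf_sum (bigD1 i) //= mcoeffZ mcoeffX eqxx mulr1 big1 ?addr0 // => j ji.
  rewrite mcoeffZ mcoeffX; case: eqP => [/mn_inj/enum_val_inj E|]; last by rewrite mulr0.
  by rewrite E eqxx in ji.
have comb0 : \sum_i v 0 i *: fe (enum_val i) = 0.
  apply/mpolyP => m; rewrite mcoeff0 raddf_sum /=.
  case: (ltnP (mdeg m) b) => mb; last first.
    apply: big1 => i _; rewrite mcoeffZ memN_msupp_eq0 ?mulr0 //.
    by apply: contraL mb => /fe_deg; rewrite ltnNge.
  have /rowP/(_ (enum_rank (BMultinom mb))) := vM; rewrite !mxE => E.
  by rewrite -[RHS]E; apply: eq_bigr => i _; rewrite mcoeffZ mxE enum_rankK.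
move=> x; transitivity (\sum_i v 0 i *: fe (enum_val i)).@[x]; last by rewrite comb0 meval0.
rewrite /q !raddf_sum /=.
apply: eq_bigr => i _; rewrite !mevalZ mevalX rmorph_prod /=; congr (_ * _).
by apply: eq_bigr => j _; rewrite rmorphXn mnmE.
Qed.

End AlgebraicDependence.

(** * First-order expansion of determinants and characteristic polynomials *)

Lemma coef1_prod_linear (K : comNzRingType) (I : eqType) (r : seq I) (a b : I -> K) : uniq r ->
  (\prod_(i <- r) ((a i)%:P + 'X * (b i)%:P))`_1 =
  \sum_(i <- r) \prod_(j <- r) (if j == i then b j else a j).
Proof.
elim: r => [|x r IH] /=; first by rewrite !big_nil coefC.
move=> /andP[xr /IH {}IH]; rewrite !big_cons mulrDl -mulrA coefD coefCM coefXM /= coefCM IH.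
have -> : (\prod_(j <- r) ((a j)%:P + 'X * (b j)%:P))`_0 = \prod_(j <- r) a j.
  rewrite -horner_coef0 horner_prod; apply: eq_bigr => j _.
  by rewrite !hornerE.
rewrite eqxx addrC; congr (_ + _).
  congr (_ * _); rewrite big_seq [RHS]big_seq; apply: eq_bigr => j jr.
  by case: eqP => // E; rewrite -E jr in xr.
rewrite big_distrr /= big_seq [RHS]big_seq; apply: eq_bigr => i ir.
by rewrite big_cons; case: eqP => // E; rewrite E ir in xr.
Qed.

(** Jacobi's formula: the derivative is the sum over [i] of the determinants with row [i] of [U]
    replaced by that of [V], each expanded along this row. *)
Lemma det_tangent (K : comNzRingType) d (U V : 'M[K]_d) :
  let D := \det (map_mx polyC U + 'X *: map_mx polyC V) in
  D`_0 = \det U /\ D`_1 = \tr (V *m \adj U).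
Proof.
split.
  rewrite -horner_coef0 -[LHS]/(horner_eval 0 _) -det_map_mx; congr (\det _).
  by apply/matrixP => i j; rewrite !mxE /= /horner_eval !hornerE.
pose W i := \matrix_(a, b) (if a == i then V a b else U a b).
transitivity (\sum_i \det (W i)).
  rewrite /determinant coef_sum exchange_big /=; apply: eq_bigr => s _.
  rewrite -big_distrr /= -polyC1 -polyCN -rmorphXn /= coefCM; congr (_ * _).
  rewrite (eq_bigr (fun i => (U i (s i))%:P + 'X * (V i (s i))%:P)); last first.
    by move=> i _; rewrite !mxE.
  rewrite coef1_prod_linear ?index_enum_uniq //; apply: eq_bigr => i _.
  by apply: eq_bigr => j _; rewrite !mxE.
rewrite /mxtrace; apply: eq_bigr => i _; rewrite (expand_det_row _ i) [RHS]mxE.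
apply: eq_bigr => j _; rewrite [W i i j]mxE eqxx [\adj U j i]mxE; congr (_ * _).
rewrite /cofactor; congr (_ * \det _); apply/matrixP => a b; rewrite !mxE.
by rewrite eq_sym (negPf (neq_lift _ _)).
Qed.

(** [swapXY] makes the perturbation parameter the outer variable, so that Jacobi's formula applies
    over polynomials in [s]; the adjugate is then expanded in powers of [A]. *)
Lemma char_poly_tangent (K : comNzRingType) d (A V : 'M[K]_d) l :
  let g := (char_poly (map_mx polyC A + 'X *: map_mx polyC V))`_l in
  g`_0 = (char_poly A)`_l /\
  g`_1 = - \sum_(k < d) (char_poly A)`_(l + k).+1 * \tr (A ^+ k *m V).
Proof.
set P := char_poly _.
have E : swapXY P = \det (map_mx polyC (char_poly_mx A) +
                          'X *: map_mx polyC (map_mx polyC (- V))).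
  rewrite /P /char_poly -det_map_mx; congr (\det _).
  apply/matrixP => i j; rewrite !mxE rmorphB rmorphMn /= swapXY_X swapXY_polyC.
  rewrite rmorphD rmorphM /= map_polyX !map_polyC /= !(rmorphB, rmorphN) /= rmorphMn.
  by rewrite mulrN opprD addrA.
have [E0 E1] := det_tangent (char_poly_mx A) (map_mx polyC (- V)).
have gE i : P`_l`_i = (swapXY P)`_i`_l by rewrite coef_swapXY.
rewrite /= !gE E E0 E1; split=> //; clear gE E E0 E1 P.
have -> : (\tr (map_mx polyC (- V) *m \adj (char_poly_mx A)))`_l =
   \tr (- V *m map_mx (fun p : {poly K} => p`_l) (\adj (char_poly_mx A))).
  rewrite /mxtrace coef_sum; apply: eq_bigr => i _; rewrite mxE [RHS]mxE coef_sum.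
  apply: eq_bigr => j _; rewrite [map_mx _ (- V) _ _]mxE coefCM; congr (_ * _).
  by rewrite [RHS]mxE.
rewrite coef_adj_char_poly_mx mulNmx raddfN /=; congr (- _).
rewrite mulmx_sumr raddf_sum /=; apply: eq_bigr => k _.
by rewrite -scalemxAr mxtraceZ mxtrace_mulC.
Qed.

(** Only the last index of each block of [e] consecutive ones contributes. *)
Lemma sum_multiples (V : zmodType) d e m (F : nat -> V) : (0 < e)%N -> d = (e * m)%N ->
  (forall k, ~~ (e %| k.+1)%N -> F k = 0) ->
  \sum_(k < d) F k = \sum_(k < m) F (e * k.+1).-1%N.
Proof.
move=> e0 -> F0; elim: m => [|m IH]; first by rewrite muln0 !big_ord0.
rewrite big_ord_recr -IH /= -!(big_mkord xpredT F) mulnS addnC.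
rewrite (@big_cat_nat _ _ _ (e * m)) ?leq_addr //=; congr (_ + _).
case: e e0 F0 {IH} => // e _ F0; rewrite addnS /= big_nat_recr ?leq_addr //=.
rewrite big_nat_cond big1 ?add0r // => k; rewrite andbT => /andP[k1 k2].
apply: F0; apply/negP => /dvdnP [q Eq].
have : (m < q)%N by rewrite -(ltn_pmul2l (ltn0Sn e)) mulnC; lia.
have : (q < m.+1)%N by rewrite -(ltn_pmul2l (ltn0Sn e)) mulnS [X in (X < _)%N]mulnC; lia.
by lia.
Qed.

(** * Closed-loop coefficients as polynomials in the entries of the feedback *)

Section SymmetricIndex.
Variable n : nat.

Lemma card_sym_pairs : #|[set p : 'I_n * 'I_n | (p.1 <= p.2)%N]| = 'C(n.+1, 2).
Proof.
rewrite cardsE -sum1_card -bin2_sum big_nat_recl // add0n big_mkord.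
rewrite -(pair_big_dep xpredT (fun i j : 'I_n => (i <= j)%N) (fun _ _ => 1%N)) /=.
rewrite (exchange_big_dep xpredT) //=; apply: eq_bigr => j _.
by rewrite -(big_ord_widen n (fun=> 1%N) (ltn_ord j)) sum1_card card_ord.
Qed.

(** Coordinates on symmetric matrices: [idx] numbers the unordered pairs and [p] picks an ordered
    representative. *)
Lemma sym_index : exists (idx : 'I_n -> 'I_n -> 'I_('C(n.+1, 2)))
    (p : 'I_('C(n.+1, 2)) -> 'I_n * 'I_n),
  [/\ forall i j, idx i j = idx j i,
      forall i j, p (idx i j) = (i, j) \/ p (idx i j) = (j, i)
    & forall k, idx (p k).1 (p k).2 = k].
Proof.
rewrite -card_sym_pairs; set S := [set p | _].
pose ord (i j : 'I_n) := if (i <= j)%N then (i, j) else (j, i).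
have ordS i j : ord i j \in S.
  by rewrite inE /ord; case: (leqP i j) => [|/ltnW].
have ordC i j : ord i j = ord j i.
  rewrite /ord; case: ltngtP => // E.
  by rewrite (val_inj E).
exists (fun i j => enum_rank_in (ordS i j) (ord i j)), (fun k => enum_val k); split.
- move=> i j; apply: enum_val_inj.
  by rewrite !enum_rankK_in // ordC.
- by move=> i j; rewrite enum_rankK_in // /ord; case: leqP; [left|right].
- move=> k; apply: enum_val_inj; rewrite enum_rankK_in //.
  have := enum_valP k; rewrite inE /ord; case: (enum_val k) => a b /= ->.
  by [].
Qed.

End SymmetricIndex.

Definition sym_mx (S : Type) n N (idx : 'I_n -> 'I_n -> 'I_N) (x : 'I_N -> S) : 'M[S]_n :=
  \matrix_(i, j) x (idx i j).

Section ClosedLoopCoefficients.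
Variables (K : fieldType) (d n N : nat) (idx : 'I_n -> 'I_n -> 'I_N).
Variables (A : 'M[K]_d) (B : 'M[K]_(d, n)) (Cm : 'M[K]_(n, d)).

Definition cl_coef l : {mpoly K[N]} :=
  (char_poly (map_mx (mpolyC N (R := K)) A + map_mx (mpolyC N (R := K)) B *m
     sym_mx idx (fun k => 'X_k) *m map_mx (mpolyC N (R := K)) Cm))`_l.

(** One naturality statement serves evaluation at a feedback as well as restriction to a line of
    feedbacks. *)
Lemma cl_coef_morph (S : comNzRingType) (phi : {rmorphism {mpoly K[N]} -> S})
    (f : K -> S) (x : 'I_N -> S) l :
  (forall a, phi a%:MP = f a) -> (forall k, phi 'X_k = x k) ->
  phi (cl_coef l) =
  (char_poly (map_mx f A + map_mx f B *m sym_mx idx x *m map_mx f Cm))`_l.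
Proof.
move=> fE xE; rewrite /cl_coef -coef_map map_char_poly; congr ((char_poly _)`_l).
have mE a b (M : 'M[K]_(a, b)) : map_mx phi (map_mx (mpolyC N (R := K)) M) = map_mx f M.
  by apply/matrixP => i j; rewrite !mxE.
have sE : map_mx phi (sym_mx idx (fun k => 'X_k)) = sym_mx idx x.
  by apply/matrixP => i j; rewrite !mxE.
by rewrite map_mxD !map_mxM !mE sE.
Qed.

Lemma cl_coef_meval x l :
  (cl_coef l).@[x] = (char_poly (A + B *m sym_mx idx x *m Cm))`_l.
Proof.
rewrite (@cl_coef_morph _ (meval x) id x) ?map_mx_id // => [a|k].
  exact: mevalC.
exact: mevalXU.
Qed.

Lemma cl_coef_line x l :
  mmap (@polyC K) (fun k => 'X * (x k)%:P) (cl_coef l) =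
  (char_poly (map_mx polyC A + 'X *: map_mx polyC (B *m sym_mx idx x *m Cm)))`_l.
Proof.
rewrite (@cl_coef_morph _ (mmap (@polyC K) (fun k => 'X * (x k)%:P)) (@polyC K)
  (fun k => 'X * (x k)%:P)) => [||k].
- congr ((char_poly (_ + _))`_l); rewrite !map_mxM scalemxAl scalemxAr.
  congr mulmx; congr mulmx; apply/matrixP => i j; rewrite !mxE //.
- exact: mmapC.
- by rewrite /= mmapX mmap1U.
Qed.

End ClosedLoopCoefficients.

(** The matrix of traces is invertible, so a linear combination of the [X l] solves the system. *)
Lemma trace_surjective (K : fieldType) m n (h X : 'I_m -> 'M[K]_n) :
  (forall l, (X l)^T = X l) -> \det (\matrix_(k, l) \tr (h k *m X l)) != 0 ->
  forall w : 'I_m -> K, exists2 Y : 'M[K]_n, Y^T = Y & forall k, \tr (h k *m Y) = w k.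
Proof.
move=> symX; set Z := \matrix_(k, l) _ => detZ w.
have uZ : Z \in unitmx by rewrite unitmxE unitfE.
pose a := invmx Z *m \col_k w k; exists (\sum_l a l 0 *: X l).
  by rewrite raddf_sum /=; apply: eq_bigr => l _; rewrite linearZ /= symX.
move=> k; have /colP/(_ k) : \col_k w k = Z *m a by rewrite mulKVmx.
rewrite mxE => ->; rewrite mxE mulmx_sumr raddf_sum /=; apply: eq_bigr => l _.
by rewrite -scalemxAr mxtraceZ [Z k l]mxE mulrC.
Qed.

(* [e = 1] is the symmetric case and [e = 2] the Hamiltonian one, where only the coefficients
   of even index are free. *)
Lemma pole_assignment (K : closedFieldType) d e m n
    (A : 'M[K]_d) (B : 'M[K]_(d, n)) (Cm : 'M[K]_(n, d)) (X : 'I_m -> 'M[K]_n) :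
  (0 < e)%N -> d = (e * m)%N ->
  (forall j, ~~ (e %| j)%N -> (char_poly A)`_j = 0) ->
  (forall l, (X l)^T = X l) ->
  \det (\matrix_(k < m, l < m) \tr (Cm *m A ^+ (e * k.+1).-1 *m B *m X l)) != 0 ->
  exists2 q : {mpoly K[m]}, q != 0 & forall c, q.@[c] != 0 ->
    exists2 F : 'M[K]_n, F^T = F &
      forall j : 'I_m, (char_poly (A + B *m F *m Cm))`_(e * j) = c j.
Proof.
move=> e0 dE chi0 symX detZ.
have [idx [p [idxC pidx idxp]]] := sym_index n.
have idxsym (x : 'I_('C(n.+1, 2)) -> K) : (sym_mx idx x)^T = sym_mx idx x.
  by apply/matrixP => i j; rewrite !mxE idxC.
suff [q nq qE] : exists2 q : {mpoly K[m]}, q != 0 &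
    forall c, q.@[c] != 0 -> exists x, forall j : 'I_m, (cl_coef idx A B Cm (e * j)).@[x] = c j.
  exists q => // c /qE [x xE]; exists (sym_mx idx x) => // j.
  by rewrite -xE cl_coef_meval.
apply: (@polynomial_image_open _ _ _ _ (fun j : 'I_m => (char_poly A)`_(e * j))) => y.
(* The derivative at zero feedback in terms of the traces, taken in reverse order: triangular since
   [chi_A] has degree [e * m], with unit diagonal since it is monic. *)
pose M := \matrix_(l < m, k < m) (char_poly A)`_(e * (l + m - k)).
have uM : M \in unitmx.
  rewrite -unitmx_tr unitmxE det_trig; last first.
    apply/is_trig_mxP => i j ij; rewrite !mxE nth_default // size_char_poly dE.
    by rewrite ltn_pmul2l // -addnBAC ?(ltnW ij) //; lia.
  rewrite big1 ?unitr1 // => i _; rewrite !mxE addKn -dE.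
  by have := monicP (char_poly_monic A); rewrite lead_coefE size_char_poly.
pose w' := invmx M *m (\col_l - y l).
pose w k := w' (rev_ord k) 0.
have [Y symY trY] := trace_surjective symX detZ w.
pose x k := Y (p k).1 (p k).2.
have xY : sym_mx idx x = Y.
  apply/matrixP => i j; rewrite mxE /x; case: (pidx i j) => -> //=.
  by rewrite -{1}symY mxE.
(* The curve is the line [t Y] of feedbacks through 0. *)
exists (fun k => 'X * (x k)%:P) => j /=; rewrite cl_coef_line xY.
have [-> ->] := char_poly_tangent A (B *m Y *m Cm) (e * j); split=> //.
rewrite (@sum_multiples _ d e m
  (fun k => (char_poly A)`_(e * j + k).+1 * \tr (A ^+ k *m (B *m Y *m Cm)))) //; last first.
  by move=> k ek; rewrite chi0 ?mul0r // -addnS dvdn_addr // dvdn_mulr.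
have tr_cyc (k : 'I_m) : \tr (A ^+ (e * k.+1).-1 *m (B *m Y *m Cm)) = w k.
  by rewrite -trY mulmxA mxtrace_mulC !mulmxA.
under eq_bigr => k _ do rewrite tr_cyc -addnS prednK ?muln_gt0 ?e0 // -mulnDr.
rewrite (reindex_inj rev_ord_inj) /=.
have := mulKVmx uM (\col_l - y l); rewrite -/w' => /colP/(_ j); rewrite [LHS]mxE [RHS]mxE => E.
rewrite -[RHS]opprK -E; congr (- _); apply: eq_bigr => k _.
rewrite /w rev_ordK [M j k]mxE; congr ((char_poly A)`_(e * _) * _).
by have := ltn_ord k; lia.
Qed.

Lemma map_mxX (K S : pzSemiRingType) (f : {rmorphism K -> S}) d (A : 'M[K]_d) k :
  map_mx f (A ^+ k) = map_mx f A ^+ k.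
Proof.
elim: k => [|k IH]; first by rewrite !expr0 -[1]/(1%:M) map_mx1.
by rewrite !exprS -IH; exact: map_mxM.
Qed.

(** * Monic polynomials in [s^e] *)

Section SpacedMonic.
Variables (K : idomainType) (e m : nat).
Hypothesis e_gt0 : (0 < e)%N.

(** Treats [monic_of] ([e = 1]) and [even_monic_of] ([e = 2]) together. *)
Definition spaced_monic (c : 'I_m -> K) : {poly K} :=
  'X^(e * m) + \sum_(i < m) c i *: 'X^(e * i).

Lemma coef_spaced_monic c (j : 'I_m) : (spaced_monic c)`_(e * j) = c j.
Proof.
rewrite coefD coefXn eqn_pmul2l // (ltn_eqF (ltn_ord j)) add0r coef_sum.
rewrite (bigD1 j) //= coefZ coefXn eqxx mulr1 big1 ?addr0 // => i /negPf ij.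
by rewrite coefZ coefXn eqn_pmul2l // eq_sym [(_ == _ :> nat)]ij mulr0.
Qed.

Lemma spaced_monicP c (p : {poly K}) :
  p \is monic -> size p = (e * m).+1 -> (forall j, ~~ (e %| j)%N -> p`_j = 0) ->
  (forall j : 'I_m, p`_(e * j) = c j) -> p = spaced_monic c.
Proof.
move=> monp szp p0 pc; apply/polyP => i.
have [/dvdnP[j ->]|ei] := boolP (e %| i)%N; last first.
  rewrite p0 // coefD coefXn coef_sum big1 => [|j _]; last first.
    rewrite coefZ coefXn; case: eqP => [E|_]; last by rewrite mulr0.
    by rewrite E dvdn_mulr in ei.
  case: eqP => [E|_]; last by rewrite addr0.
  by rewrite E dvdn_mulr in ei.
rewrite mulnC; case: (ltngtP j m) => [jm|jm|->].
- by rewrite -[j]/(val (Ordinal jm)) pc coef_spaced_monic.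
- rewrite nth_default ?szp ?ltn_pmul2l // coefD coefXn eqn_pmul2l // (gtn_eqF jm) add0r.
  rewrite coef_sum big1 // => i' _; rewrite coefZ coefXn eqn_pmul2l //.
  by rewrite (gtn_eqF (ltn_trans (ltn_ord i') jm)) mulr0.
- have := monicP monp; rewrite lead_coefE szp /= => ->.
  rewrite coefD coefXn eqxx coef_sum big1 ?addr0 // => i' _.
  by rewrite coefZ coefXn eqn_pmul2l // (gtn_eqF (ltn_ord i')) mulr0.
Qed.

End SpacedMonic.

(** * Criteria for and against generic assignability *)

Section Assignability.
Variable R : realType.
Local Notation C := (R[i]).
Local Notation Cs := {fraction {poly C}}.
Implicit Types d n e m : nat.

Lemma contains_nonempty_open_sub N (P Q : ('I_N -> C) -> Prop) :
  (forall c, P c -> Q c) -> contains_nonempty_open P -> contains_nonempty_open Q.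
Proof. by move=> PQ [O [zO [neO OP]]]; exists O; do 2!split=> //; move=> x /OP/PQ. Qed.

Lemma monic_ofE d (c : 'I_d -> C) : monic_of c = spaced_monic 1 c.
Proof.
rewrite /monic_of /spaced_monic mul1n; congr (_ + _).
by apply: eq_bigr => i _; rewrite mul1n.
Qed.

Lemma cl_charpolys_of_real d n (G : 'M[Cs]_n) p :
  cl_charpolys_real d G p -> cl_charpolys d G p.
Proof.
move=> [F [symF H]]; exists (map_mx (fun x : R => (x%:C)%C) F); split=> //.
by rewrite map_trmx symF.
Qed.

(** Let [q] be a relation among the closed-loop coefficients and [r] an equation that fails at a
    point of the open set. Where [r] is nonzero the point is attained, so [q] vanishes there; thus
    [r * q = 0], which forces [r = 0]. *)
Lemma not_assignable e m d n (G : 'M[Cs]_n) :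
  (0 < e)%N -> ('C(n.+1, 2) < m)%N -> mcmillan_degree G d ->
  ~ contains_nonempty_open (fun c : 'I_m -> C => cl_charpolys d G (spaced_monic e c)).
Proof.
move=> e0 nm minG [O [[S OS] [[x0 Ox0] OP]]].
have [[A [B [Cm EG]]] _] := minG.
have [idx [p [idxC pidx _]]] := sym_index n.
have [q nq q0] := algebraic_dependence (fun j : 'I_m => cl_coef idx A B Cm (e * j)) nm.
have := (OS x0).1 Ox0; apply => r Sr; apply/eqP/negPn/negP => rx0.
have rq0 : r * q = 0.
  apply: mpoly_vanishing => c; rewrite mevalM.
  have [->|rc] := eqVneq r.@[c] 0; first by rewrite mul0r.
  have [F [symF [A' [B' [C' [E' cE]]]]]] : cl_charpolys d G (spaced_monic e c).
    by apply: OP; apply/OS => /(_ r Sr) rc0; rewrite rc0 eqxx in rc.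
  rewrite -[q.@[c]](@meval_eq _ _ (fun j : 'I_m =>
    (cl_coef idx A B Cm (e * j)).@[fun k => F (p k).1 (p k).2])) ?q0 ?mulr0 // => j.
  have cE' : spaced_monic e c = cl_charpoly A B Cm F.
    rewrite cE; apply: cl_charpoly_realization; first by rewrite E'.
    by rewrite E' EG.
  rewrite cl_coef_meval -(coef_spaced_monic e0 c) cE' /cl_charpoly.
  suff -> : sym_mx idx (fun k => F (p k).1 (p k).2) = F by [].
  apply/matrixP => a b; rewrite mxE; case: (pidx a b) => -> //=.
  by rewrite -[in RHS]symF mxE.
move/eqP: rq0; rewrite mulf_eq0 (negPf nq) orbF => /eqP r0.
by rewrite r0 meval0 eqxx in rx0.
Qed.

(** Linear independence of [m] Markov parameters as functionals on symmetric matrices, in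
    determinant form so that openness can be read off. *)
Definition markov_nondegenerate e m d n
    (A : 'M[C]_d) (B : 'M[C]_(d, n)) (Cm : 'M[C]_(n, d)) : Prop :=
  exists2 X : 'I_m -> 'M[C]_n, (forall l, (X l)^T = X l) &
    \det (\matrix_(k < m, l < m) \tr (Cm *m A ^+ (e * k.+1).-1 *m B *m X l)) != 0.

Lemma markov_nondegenerateI e m d n
    (A : 'M[C]_d) (B : 'M[C]_(d, n)) (Cm : 'M[C]_(n, d)) (h X : 'I_m -> 'M[C]_n) :
  (forall l, (X l)^T = X l) -> \det (\matrix_(k, l) \tr (h k *m X l)) != 0 ->
  (forall k : 'I_m, Cm *m A ^+ (e * k.+1).-1 *m B = h k) ->
  markov_nondegenerate e m A B Cm.
Proof.
move=> symX detX hE; exists X; first exact: symX.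
suff -> : (\matrix_(k < m, l < m) \tr (Cm *m A ^+ (e * k.+1).-1 *m B *m X l)) =
          \matrix_(k, l) \tr (h k *m X l) by exact: detX.
by apply/matrixP => k l; rewrite [LHS]mxE [RHS]mxE hE.
Qed.

Lemma markov_nondegenerate_tf e m d n
    (A A' : 'M[C]_d) (B B' : 'M[C]_(d, n)) (Cm Cm' : 'M[C]_(n, d)) :
  tf A B Cm = tf A' B' Cm' ->
  markov_nondegenerate e m A B Cm -> markov_nondegenerate e m A' B' Cm'.
Proof.
move=> /tf_markov h [X symX detX]; apply: markov_nondegenerateI symX detX _ => k.
exact/esym/h.
Qed.

(** For fixed [X] the determinant is a polynomial in the entries of the triple; the family over all
    symmetric [X] defines the open set. *)
Lemma markov_nondegenerate_open e m d n :
  exists2 O : ('I_(d * d + (d * n + n * d)) -> C) -> Prop, zariski_open O &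
    forall (A : 'M[C]_d) (B : 'M[C]_(d, n)) (Cm : 'M[C]_(n, d)),
      O (triple_coords A B Cm) <-> markov_nondegenerate e m A B Cm.
Proof.
pose T := (d * d + (d * n + n * d))%N.
pose gA : 'M[{mpoly C[T]}]_d := \matrix_(i, j) 'X_(lshift _ (mxvec_index i j)).
pose gB : 'M[{mpoly C[T]}]_(d, n) :=
  \matrix_(i, j) 'X_(rshift _ (lshift _ (mxvec_index i j))).
pose gC : 'M[{mpoly C[T]}]_(n, d) :=
  \matrix_(i, j) 'X_(rshift _ (rshift _ (mxvec_index i j))).
pose g (X : 'I_m -> 'M[C]_n) := \det (\matrix_(k < m, l < m)
  \tr (gC *m gA ^+ (e * k.+1).-1 *m gB *m map_mx (mpolyC T (R := C)) (X l))).
pose S p := exists2 X : 'I_m -> 'M[C]_n, (forall l, (X l)^T = X l) & p = g X.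
exists (fun x => ~ (forall p, S p -> p.@[x] = 0)); first by exists S.
move=> A B Cm; set x := triple_coords A B Cm.
have EA : map_mx (meval x) gA = A.
  by apply/matrixP => i j; rewrite !mxE mevalXU /x /triple_coords row_mxEl mxvecE.
have EB : map_mx (meval x) gB = B.
  by apply/matrixP => i j; rewrite !mxE mevalXU /x /triple_coords row_mxEr row_mxEl mxvecE.
have EC : map_mx (meval x) gC = Cm.
  by apply/matrixP => i j; rewrite !mxE mevalXU /x /triple_coords !row_mxEr mxvecE.
have gE X : (g X).@[x] =
    \det (\matrix_(k < m, l < m) \tr (Cm *m A ^+ (e * k.+1).-1 *m B *m X l)).
  rewrite -det_map_mx; congr (\det _); apply/matrixP => k l; rewrite !mxE.
  rewrite -trace_map_mx !map_mxM map_mxX EA EB EC -map_mx_comp.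
  by congr (\tr (_ *m _)); apply/matrixP => i j; rewrite !mxE /= mevalC.
split.
  move=> nO; apply: boolp.contrapT => nX; apply: nO => _ [X symX ->].
  rewrite gE; apply/eqP/negPn/negP => detX; apply: nX.
  by exists X.
move=> [X symX detX] /(_ (g X)) H; move: detX; rewrite -gE H ?eqxx //.
by exists X.
Qed.

(** [U] consists of the members of [V] with nondegenerate Markov parameters, a property of the
    transfer function alone. The vanishing hypothesis ensures that the coefficients of index [e * j]
    determine the closed-loop polynomial. *)
Lemma assignable e m d n (V : 'M[Cs]_n -> Prop) :
  (0 < e)%N -> d = (e * m)%N ->
  (forall (A : 'M[C]_d) (B : 'M[C]_(d, n)) (Cm : 'M[C]_(n, d)) F j,
     V (tf A B Cm) -> F^T = F -> ~~ (e %| j)%N -> (cl_charpoly A B Cm F)`_j = 0) ->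
  (exists (A : 'M[C]_d) (B : 'M[C]_(d, n)) (Cm : 'M[C]_(n, d)),
     V (tf A B Cm) /\ markov_nondegenerate e m A B Cm) ->
  exists U : 'M[Cs]_n -> Prop,
    open_in_variety d V U /\ (exists G, U G) /\
    forall G, U G ->
      contains_nonempty_open (fun c : 'I_m -> C => cl_charpolys d G (spaced_monic e c)).
Proof.
move=> e0 dE gap [A0 [B0 [C0 [V0 nd0]]]].
pose U G := V G /\ exists (A : 'M[C]_d) (B : 'M[C]_(d, n)) (Cm : 'M[C]_(n, d)),
  tf A B Cm = G /\ markov_nondegenerate e m A B Cm.
exists U; split.
  split=> [G [] //|]; have [O zO OE] := markov_nondegenerate_open e m d n.
  exists O; split=> // A B Cm VG; split.
    move=> [_ [A' [B' [C' [E nd]]]]]; apply/OE.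
    exact: markov_nondegenerate_tf E nd.
  by move=> /OE nd; split=> //; exists A, B, Cm.
split; first by exists (tf A0 B0 C0); split=> //; exists A0, B0, C0.
move=> G [VG [A [B [Cm [E [X symX detX]]]]]]; subst G.
(* The open loop is the case of zero feedback. *)
have gapA j : ~~ (e %| j)%N -> (char_poly A)`_j = 0.
  move=> ej; have := @gap A B Cm 0 j VG (trmx0 _ _ _) ej.
  by rewrite /cl_charpoly mulmx0 mul0mx addr0.
have [q nq qE] := pole_assignment e0 dE gapA symX detX.
exists (fun c => ~ (forall p, p = q -> p.@[c] = 0)); split; first by exists (eq^~ q).
split.
  have [x qx] : exists x, q.@[x] != 0.
    apply: boolp.contrapT => nx; case/negP: nq; apply/eqP/mpoly_vanishing => x.
    by apply/eqP/negPn/negP => qx; apply: nx; exists x.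
  by exists x => /(_ q erefl) qx0; rewrite qx0 eqxx in qx.
move=> c nqc; have qc : q.@[c] != 0.
  by apply/negP => /eqP qc0; apply: nqc => _ ->.
have [F symF FE] := qE c qc; exists F; split=> //; exists A, B, Cm; split=> //.
apply/esym/spaced_monicP; first exact: e0.
- exact: char_poly_monic.
- by rewrite size_char_poly dE.
- by move=> j ej; apply: gap.
- exact: FE.
Qed.

End Assignability.

(** * Systems with independent Markov parameters *)

Section DualVectors.
Variable K : numFieldType.

Lemma sum_mulr_delta (I : finType) (F : I -> K) u : \sum_j F j * (j == u)%:R = F u.
Proof.
rewrite (bigD1 u) //= eqxx mulr1 big1 ?addr0 // => j /negPf ->.
by rewrite mulr0.
Qed.

(* The vectors are the [e_i + e_j] with [i <= j]; a quadratic form is recovered from its values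
   at them by polarization. *)
Lemma quadratic_dual_vectors n m : (m <= 'C(n.+1, 2))%N ->
  exists (b : 'M[K]_(m, n)) (X : 'I_m -> 'M[K]_n),
    (forall l, (X l)^T = X l) /\
    forall i l, (b *m X l *m b^T) i i = (i == l)%:R.
Proof.
move=> mN; have [idx [p [idxC pidx idxp]]] := sym_index n.
pose v i := p (widen_ord mN i).
pose w l i j : K := (idx i j == widen_ord mN l)%:R.
exists (\matrix_(i, j) ((j == (v i).1)%:R + (j == (v i).2)%:R)).
(* The pair [(i, i)] yields the vector [2 e_i], so the diagonal entry is [w l i i / 4]; the value at
   [e_i + e_j] then fixes the entry at [(i, j)]. *)
exists (fun l => \matrix_(i, j) ((w l i j - w l i i / 4 - w l j j / 4) / 2)); split.
  move=> l; apply/matrixP => i j; rewrite !mxE /w idxC; ring.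
move=> i l; set b := \matrix_(i, j) _; set X := \matrix_(i, j) _.
have mulb (y : 'I_n -> K) : \sum_j y j * b i j = y (v i).1 + y (v i).2.
  rewrite -!sum_mulr_delta -big_split; apply: eq_bigr => j _.
  by rewrite mxE mulrDr.
have bX j : (b *m X) i j = X (v i).1 j + X (v i).2 j.
  by rewrite mxE -(mulb (X^~ j)); apply: eq_bigr => k _; rewrite mulrC.
rewrite mxE (eq_bigr (fun j => (b *m X) i j * b i j)); last by move=> j _; rewrite [b^T _ _]mxE.
rewrite (mulb (fun j => (b *m X) i j)) !bX /X !mxE.
have -> : (i == l)%:R = w l (v i).1 (v i).2.
  by rewrite /w idxp -val_eqE.
have -> : w l (v i).2 (v i).1 = w l (v i).1 (v i).2 by rewrite /w idxC.
by field.
Qed.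

Lemma diag_mx_powM m n (a : 'rV[K]_m) k (M : 'M[K]_(m, n)) :
  diag_mx a ^+ k *m M = \matrix_(i, j) (a 0 i ^+ k * M i j).
Proof.
elim: k => [|k IH]; first by apply/matrixP => i j; rewrite expr0 mul1mx !mxE expr0 mul1r.
rewrite -mulmx_powS IH mul_diag_mx; apply/matrixP => i j.
by rewrite !mxE exprS mulrA.
Qed.

(** With [D] diagonal, duality turns the trace at [(k, l)] into [a_l^k]: a Vandermonde matrix, whose
    nodes [0, ..., m - 1] are distinct in characteristic 0. *)
Lemma vandermonde_nondegenerate n m : (m <= 'C(n.+1, 2))%N ->
  exists (D : 'M[K]_m) (b : 'M[K]_(m, n)) (X : 'I_m -> 'M[K]_n),
    [/\ D^T = D, forall l, (X l)^T = X l &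
      \det (\matrix_(k < m, l < m) \tr (b^T *m D ^+ k *m b *m X l)) != 0].
Proof.
move=> /quadratic_dual_vectors [b [X [symX dualX]]].
pose a : 'rV[K]_m := \row_i i%:R.
exists (diag_mx a), b, X; split=> //; first exact: tr_diag_mx.
have -> : (\matrix_(k < m, l < m) \tr (b^T *m diag_mx a ^+ k *m b *m X l)) = Vandermonde m a.
  apply/matrixP => k l; rewrite [RHS]mxE mxE.
  have -> : \tr (b^T *m diag_mx a ^+ k *m b *m X l) =
            \tr (diag_mx a ^+ k *m (b *m X l *m b^T)).
    by rewrite -!mulmxA mxtrace_mulC !mulmxA.
  rewrite diag_mx_powM /mxtrace (eq_bigr (fun i => a 0 i ^+ k * (i == l)%:R)).
    exact: sum_mulr_delta.
  by move=> i _; rewrite mxE dualX.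
rewrite det_Vandermonde; apply/prodf_neq0 => i _; apply/prodf_neq0 => j ij.
by rewrite !mxE subr_eq0 eqr_nat gtn_eqF.
Qed.

(** Realizes [b^T (s^2 - D)^-1 b]: the square of the block matrix [A] is [D] on both diagonal
    blocks. *)
Lemma doubled_realization d m n (D : 'M[K]_m) (b : 'M[K]_(m, n)) : d = (m + m)%N ->
  exists (A : 'M[K]_d) (B : 'M[K]_(d, n)) (Cm : 'M[K]_(n, d)), forall k,
    Cm *m A ^+ k.*2 *m B = 0 /\ Cm *m A ^+ k.*2.+1 *m B = b^T *m D ^+ k *m b.
Proof.
move=> ->; pose A : 'M[K]_(m + m) := block_mx 0 1%:M D 0.
pose B : 'M[K]_(m + m, n) := col_mx 0 b.
exists A, B, (row_mx b^T 0) => k.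
have odd_pow l : A ^+ l.*2 *m B = col_mx 0 (D ^+ l *m b) ->
                 A ^+ l.*2.+1 *m B = col_mx (D ^+ l *m b) 0.
  move=> E; rewrite -mulmx_powS E mul_block_col.
  by rewrite !mul0mx !mulmx0 mul1mx add0r addr0.
have even_pow l : A ^+ l.*2 *m B = col_mx 0 (D ^+ l *m b).
  elim: l => [|l IH]; first by rewrite !expr0 !mul1mx.
  rewrite doubleS -mulmx_powS (odd_pow _ IH) mul_block_col.
  by rewrite !mul0mx !mulmx0 !addr0 mulmx_powS.
rewrite -!mulmxA (odd_pow _ (even_pow k)) even_pow !mul_row_col.
by rewrite !mul0mx !mulmx0 !addr0.
Qed.

End DualVectors.

(** * Examples that make the open sets nonempty *)

Section Examples.
Variable R : realType.
Local Notation C := (R[i]).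

(* A smaller realization would give a linear recurrence with leading coefficient 1 of order
   less than [d] among the Markov parameters. *)
Lemma nondegenerate_minimal e m d n
    (A : 'M[C]_d) (B : 'M[C]_(d, n)) (Cm : 'M[C]_(n, d)) :
  (0 < e)%N -> d = (e * m)%N -> markov_nondegenerate e m A B Cm ->
  (forall k, ~~ (e %| k.+1)%N -> Cm *m A ^+ k *m B = 0) ->
  mcmillan_degree (tf A B Cm) d.
Proof.
move=> e0 dE [X symX detX] gap; split; first by exists A, B, Cm.
move=> k kd [A' [B' [C' /tf_markov h]]].
have tm : (k %/ e < m)%N by rewrite ltn_divLR // mulnC -dE.
pose t := Ordinal tm.
(* [W] is the least multiple of [e] above [k]. The offset [r] puts the last term of the recurrence,
   [i = k], at the Markov parameter of index [W - 1], the only one among those of index less than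
   [d] whose trace against [Y] is nonzero. *)
have [W WE kt] : exists2 W, W = (e * t.+1)%N & (k < W)%N.
  by exists (e * t.+1)%N; rewrite // mulnC ltn_ceil.
pose r := (W.-1 - k)%N.
have [Y symY trY] := trace_surjective symX detX (fun l => (l == t)%:R).
have tr_h i : (i <= k)%N -> \tr (Cm *m A ^+ (r + i) *m B *m Y) = (i == k)%:R.
  move=> ik; have [/dvdnP[u Eu]|nd] := boolP (e %| (r + i).+1)%N; last first.
    rewrite gap // mul0mx raddf0; case: eqP => // E; case/negP: nd.
    have -> : (r + i).+1 = W by rewrite E /r; lia.
    by rewrite WE dvdn_mulr.
  case: u Eu => [|u] Eu; first by rewrite mul0n in Eu.
  rewrite mulnC in Eu; have uW : (e * u.+1 <= W)%N by rewrite -Eu /r; lia.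
  have ut : (u <= t)%N by rewrite WE leq_pmul2l // ltnS in uW.
  have -> : (r + i)%N = (e * u.+1).-1 by rewrite -Eu.
  rewrite (trY (Ordinal (leq_ltn_trans ut tm))) -val_eqE /=.
  have -> : (u == k %/ e)%N = (e * u.+1 == W)%N by rewrite WE eqn_pmul2l // eqSS.
  by rewrite -Eu /r; congr ((nat_of_bool _)%:R); lia.
have : \tr (C' *m A' ^+ r *m (\sum_(i < k.+1) (char_poly A')`_i *: A' ^+ i) *m B' *m Y) = 0.
  by rewrite char_poly_annihilates mulmx0 !mul0mx raddf0.
rewrite mulmx_sumr !mulmx_suml raddf_sum /=.
rewrite (eq_bigr (fun i : 'I_k.+1 => (char_poly A')`_i * (i == ord_max)%:R)).
  rewrite sum_mulr_delta /=.
  have := monicP (char_poly_monic A'); rewrite lead_coefE size_char_poly /= => ->.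
  by move/eqP; rewrite oner_eq0.
move=> i _; rewrite -scalemxAr -!scalemxAl mxtraceZ; congr (_ * _).
have -> : (i == ord_max) = (i == k :> nat) by [].
rewrite -(tr_h i); last by rewrite -ltnS.
by rewrite -(h (r + i)%N) mulmx_expD.
Qed.

Lemma symmetric_example n d : (d <= 'C(n.+1, 2))%N ->
  exists (A : 'M[C]_d) (B : 'M[C]_(d, n)) (Cm : 'M[C]_(n, d)),
    SRat d (tf A B Cm) /\ markov_nondegenerate 1 d A B Cm.
Proof.
move=> /(vandermonde_nondegenerate C) [D [b [X [symD symX detX]]]].
have nd : markov_nondegenerate 1 d D b b^T.
  by apply: markov_nondegenerateI symX detX _ => k; rewrite mul1n.
exists D, b, b^T; split; last exact: nd.
split; last by rewrite /symmetric_tf tf_tr symD trmxK.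
apply: (nondegenerate_minimal (ltn0Sn 0) _ nd); first by rewrite mul1n.
by move=> k; rewrite dvd1n.
Qed.

(** [G(-s)] has the Markov parameters [(-1)^(k+1) h_k], and Markov parameters determine the transfer
    function. *)
Lemma hamiltonian_of_markov d n
    (A : 'M[C]_d) (B : 'M[C]_(d, n)) (Cm : 'M[C]_(n, d)) :
  (forall k, (-1) ^+ k.+1 *: (Cm *m A ^+ k *m B) = (Cm *m A ^+ k *m B)^T) ->
  hamiltonian_tf (tf A B Cm).
Proof.
move=> h; exists d, A, B, Cm; split; first by [].
apply: trmx_inj; rewrite trmxK.
rewrite tf_tr tf_negE.
apply: markov_tf => k.
apply: (etrans (markovN A B Cm k)).
apply: (etrans (h k)).
exact/esym/tr_markov.
Qed.

(** In the doubled system the Markov parameters of even index vanish and those of odd index are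
    symmetric, which is the Hamiltonian sign rule. *)
Lemma hamiltonian_example n m : (2 * m <= n * n.+1)%N ->
  exists (A : 'M[C]_(2 * m)) (B : 'M[C]_(2 * m, n)) (Cm : 'M[C]_(n, 2 * m)),
    Ham (2 * m) (tf A B Cm) /\ markov_nondegenerate 2 m A B Cm.
Proof.
move=> mn; have mN : (m <= 'C(n.+1, 2))%N by rewrite bin2 /=; lia.
have [D [b [X [symD symX detX]]]] := vandermonde_nondegenerate C mN.
have dE : (2 * m)%N = (m + m)%N by rewrite mul2n addnn.
have [A [B [Cm h]]] := doubled_realization D b dE.
have nd : markov_nondegenerate 2 m A B Cm.
  apply: markov_nondegenerateI symX detX _ => k.
  by rewrite [(2 * k.+1)%N]mul2n doubleS /= (h k).2.
have gap k : ~~ (2 %| k.+1)%N -> Cm *m A ^+ k *m B = 0.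
  rewrite dvdn2 negbK /= => ek.
  by rewrite -[k]odd_double_half (negPf ek) add0n (h _).1.
exists A, B, Cm; split; last exact: nd.
split; first exact: nondegenerate_minimal (ltn0Sn 1) erefl nd gap.
apply: hamiltonian_of_markov => k.
have [ok|ek] := boolP (odd k); last first.
  by rewrite gap ?scaler0 ?trmx0 // dvdn2 negbK.
rewrite -signr_odd /= ok expr0 scale1r -[k]odd_double_half ok add1n (h _).2.
by rewrite !trmx_mul trmxK -trmxX symD mulmxA.
Qed.

End Examples.

Theorem mainTheorem5 (R : realType) (n : nat) :
  (* (a) symmetric case: delta > binom(n+1,2) => not generically pole assignable *)
  (forall (d : nat) (G : 'M[{fraction {poly R[i]}}]_n),
      ('C(n.+1, 2) < d)%N -> SRat d G ->
      ~ contains_open_monic d (cl_charpolys d G) /\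
      ~ contains_open_monic d (cl_charpolys_real d G)) /\
  (* (a) Hamiltonian case: delta = 2m > n(n+1) *)
  (forall (m : nat) (G : 'M[{fraction {poly R[i]}}]_n),
      (n * n.+1 < 2 * m)%N -> Ham (2 * m) G ->
      ~ contains_open_even_monic m (cl_charpolys (2 * m) G) /\
      ~ contains_open_even_monic m (cl_charpolys_real (2 * m) G)) /\
  (* (b) symmetric case: delta <= binom(n+1,2) *)
  (forall d : nat, (d <= 'C(n.+1, 2))%N ->
      exists U : 'M[{fraction {poly R[i]}}]_n -> Prop,
        open_in_variety d (fun G => SRat d G) U /\ (exists G, U G) /\
        forall G, U G -> contains_open_monic d (cl_charpolys d G)) /\
  (* (b) Hamiltonian case: delta = 2m <= n(n+1) *)
  (forall m : nat, (2 * m <= n * n.+1)%N ->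
      exists U : 'M[{fraction {poly R[i]}}]_n -> Prop,
        open_in_variety (2 * m) (fun G => Ham (2 * m) G) U /\ (exists G, U G) /\
        forall G, U G -> contains_open_even_monic m (cl_charpolys (2 * m) G)).
Proof.
split; [|split; [|split]].
- move=> d G nd [minG _]; have not_open := not_assignable (ltn0Sn 0) nd minG.
  split=> H; apply: not_open; apply: contains_nonempty_open_sub H => c.
    by rewrite monic_ofE.
  by rewrite monic_ofE; exact: cl_charpolys_of_real.
(* An even polynomial of degree [2 * m] has only [m] free coefficients, which halves the bound. *)
- move=> m G nm [minG _]; have nd : ('C(n.+1, 2) < m)%N by rewrite bin2 /=; lia.
  have not_open := not_assignable (ltn0Sn 1) nd minG.
  (* [even_monic_of] agrees with [spaced_monic 2] by unfolding. *)
  split=> H; apply: not_open; apply: contains_nonempty_open_sub H => c //.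
  exact: cl_charpolys_of_real.
- move=> d dn; have [|A B Cm F j _ _||U [openU [neU HU]]] :=
    @assignable R 1 d d n (fun G => SRat d G) (ltn0Sn 0).
  + by rewrite mul1n.
  + by rewrite dvd1n.
  + exact: symmetric_example.
  exists U; do 2!split=> //; move=> G /HU; apply: contains_nonempty_open_sub => c.
  by rewrite monic_ofE.
- move=> m mn; apply: (@assignable R 2 m (2 * m) n (fun G => Ham (2 * m) G)) => //.
    move=> A B Cm F j hamG symF; rewrite dvdn2 negbK.
    exact: hamiltonian_cl_charpoly_even hamG erefl symF.
  exact: hamiltonian_example.
Qed.
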